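(* Let $1 \le m \le n$ be integers and let $A \subseteq \mathbb{H}^n$ be a Borel set. Then for $\mu_{n,m}$-a.e. $V\in G_h(n,m)$, $$\dim_{\mathbb{H}^n} P^L_{\mathbb{V}^{\perp}}(A) \ge \begin{cases} \dim_{\mathbb{H}^n}A - 1 & \text{if } \dim_{\mathbb{H}^n}A\in[2,2n-m+1],\\ 2n-m & \text{if } \dim_{\mathbb{H}^n}A\in[2n-m+1,2n+1].\end{cases}$$
   Context: The Heisenberg group $\mathbb{H}^n$ is $\mathbb{R}^{2n}\times\mathbb{R}$, with points $(z,t)$, $z=(x_1,\dots,x_n,y_1,\dots,y_n)$, and group law $(z,t)*(w,s)=(z+w,\,t+s+\tfrac12\omega(z,w))$, where for $w=(u_1,\dots,u_n,v_1,\dots,v_n)$, $\omega(z,w)=\sum_{j=1}^n(x_jv_j-y_ju_j)$. The notation $\dim_{\mathbb{H}^n}$ denotes Hausdorff dimension with respect to the Korányi metric $d_{\mathbb{H}^n}(p,q)=\|q^{-1}*p\|$, $\|(z,t)\|^4=|z|^4+16t^2$ (equivalently, with respect to the Carnot–Carathéodory metric $d_{cc}$, which is bi-Lipschitz equivalent to it). $G_h(n,m)$ is the set of $m$-dimensional isotropic linear subspaces $V$ of $\mathbb{R}^{2n}\cong\mathbb{C}^n$ (i.e. $\omega$ vanishes on $V\times V$), and $\mu_{n,m}$ is the unique probability measure on $G_h(n,m)$ invariant under the unitary group $U(n)$. For $V\in G_h(n,m)$ put $\mathbb{V}=V\times\{0\}$, $\mathbb{V}^\perp=V^\perp\times\mathbb{R}$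 ($V^\perp$ is the Euclidean orthogonal complement in $\mathbb{R}^{2n}$). Let $P_{\mathbb{V}}(z,t)=(\pi_V(z),0)$, where $\pi_V$ is Euclidean orthogonal projection onto $V$. The (left coset) vertical projection is $P^L_{\mathbb{V}^\perp}:\mathbb{H}^n\to\mathbb{V}^\perp$, $P^L_{\mathbb{V}^\perp}(p)=p*P_{\mathbb{V}}(p)^{-1}$. *)

(* Defs.v *)
From HB Require Import structures.
From mathcomp Require Import all_boot all_order all_algebra.
From mathcomp Require Import complex.
From mathcomp Require Import all_classical all_reals all_analysis.

Set Implicit Arguments.
Unset Strict Implicit.
Unset Printing Implicit Defensive.

Import Order.TTheory GRing.Theory Num.Theory.
Import numFieldNormedType.Exports.

Local Open Scope classical_set_scope.
Local Open Scope ring_scope.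

Definition borel {T : topologicalType} : set (set T) := <<s (@open T) >>.

Definition borelType (T : ptopologicalType) := g_sigma_algebraType (@open T).

(* The supremum in [diam] is [-oo] for the empty set; [gauge] makes empty
   members of a covering contribute 0 (so finite coverings are included) and
   any other set E contribute diam(E)^s, with 0^0 = 1. *)

Definition diam {R : realType} {T : Type} (d : T -> T -> R) (E : set T) : \bar R :=
  ereal_sup [set (d p.1 p.2)%:E | p in E `*` E].

Definition gauge {R : realType} {T : Type} (d : T -> T -> R) (s : R) (E : set T)
    : \bar R :=
  if E == set0 then 0%E else poweR (diam d E) s.

Definition hausdorff_content {R : realType} {T : Type} (d : T -> T -> R)
    (s delta : R) (A : set T) : \bar R :=
  ereal_inf [set (\sum_(0 <= i <oo) gauge d s (E i))%E | E in
    [set E : nat -> set T |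
      A `<=` \bigcup_i E i /\ forall i, (diam d (E i) <= delta%:E)%E]].

Definition hausdorff_measure {R : realType} {T : Type} (d : T -> T -> R)
    (s : R) (A : set T) : \bar R :=
  ereal_sup [set hausdorff_content d s delta A | delta in [set r : R | 0 < r]].

Definition hausdorff_dim {R : realType} {T : Type} (d : T -> T -> R) (A : set T)
    : \bar R :=
  ereal_inf [set s%:E | s in
    [set s : R | 0 <= s /\ hausdorff_measure d s A = 0%E]].

(* R^2n is 'rV_(n + n), with z = row_mx x y.  The built-in norm of 'rV_k
   is the sup norm, so the Euclidean norm is defined from [dotv]. *)

Definition dotv {R : realType} {k : nat} (v w : 'rV[R]_k) : R :=
  \sum_(j < k) v 0 j * w 0 j.

Definition enorm {R : realType} {k : nat} (v : 'rV[R]_k) : R :=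
  Num.sqrt (dotv v v).

Definition omega {R : realType} {n : nat} (z w : 'rV[R]_(n + n)) : R :=
  \sum_(j < n) (lsubmx z 0 j * rsubmx w 0 j - rsubmx z 0 j * lsubmx w 0 j).

Definition orthv {R : realType} {k : nat} (V : {vspace 'rV[R]_k})
    : {vspace 'rV[R]_k} :=
  lker (linfun (mulmxr (\matrix_(i < \dim V) (vbasis V)`_i)^T)).

Definition orth_proj {R : realType} {k : nat} (V : {vspace 'rV[R]_k})
    : 'End('rV[R]_k) :=
  daddv_pi V (orthv V).

Lemma dotvE {R : realType} {k : nat} (v w : 'rV[R]_k) :
  dotv v w = (v *m w^T) 0 0.
Proof. by rewrite !mxE; apply: eq_bigr => j _; rewrite !mxE. Qed.

Lemma dotvC {R : realType} {k : nat} (v w : 'rV[R]_k) : dotv v w = dotv w v.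
Proof. by apply: eq_bigr => j _; rewrite mulrC. Qed.

Lemma memv_orthvP {R : realType} {k : nat} (V : {vspace 'rV[R]_k}) w :
  reflect (forall v, v \in V -> dotv v w = 0) (w \in orthv V).
Proof.
rewrite memv_ker lfunE /=; apply: (iffP eqP) => [w0 v vV|w0].
  rewrite dotvC dotvE (coord_vbasis vV) linear_sum mulmx_sumr summxE big1// => i _.
  rewrite linearZ -scalemxAr mxE; apply/eqP; rewrite mulf_eq0; apply/orP; right.
  move/matrixP: w0 => /(_ 0 i); rewrite !mxE => w0; apply/eqP; rewrite -[RHS]w0.
  by apply: eq_bigr => j _; rewrite !mxE.
apply/matrixP => i0 i; rewrite ord1 mxE [RHS]mxE -[RHS](w0 (vbasis V)`_i).
  by apply: eq_bigr => j _; rewrite !mxE mulrC.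
by rewrite vbasis_mem// mem_nth// size_tuple.
Qed.

Lemma capv_orthv {R : realType} {k : nat} (V : {vspace 'rV[R]_k}) :
  (V :&: orthv V = 0)%VS.
Proof.
apply/eqP; rewrite -subv0; apply/subvP => v /memv_capP[vV /memv_orthvP/(_ _ vV)].
rewrite memv0 => /eqP; rewrite psumr_eq0; last by move=> i _; rewrite -expr2 sqr_ge0.
move=> /allP v0; apply/eqP/rowP => j; rewrite mxE.
by have := v0 j (mem_index_enum _); rewrite mulf_eq0 orbb => /eqP.
Qed.

Lemma addv_orthv {R : realType} {k : nat} (V : {vspace 'rV[R]_k}) :
  (V + orthv V)%VS = fullv.
Proof.
apply/eqP; rewrite eqEdim subvf /= dimv_disjoint_sum ?capv_orthv//.
rewrite -(limg_ker_dim (linfun (mulmxr (\matrix_(i < \dim V) (vbasis V)`_i)^T)) fullv).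
rewrite capfv addnC leq_add2r (leq_trans (dimvS (subvf _)))//.
by rewrite dimvf /dim /= mul1n.
Qed.

Lemma orth_projP {R : realType} {k : nat} (V : {vspace 'rV[R]_k}) z :
  orth_proj V z \in V /\ z - orth_proj V z \in orthv V.
Proof.
split; first exact: memv_pi.
have zE := daddv_pi_add (capv_orthv V) (w := z).
rewrite -[X in X - _]zE ?addv_orthv ?memvf// /orth_proj addrAC subrr add0r.
exact: memv_pi.
Qed.

Definition heis (R : realType) (n : nat) := ('rV[R]_(n + n) * R)%type.

Definition heis_mul {R : realType} {n : nat} (p q : heis R n) : heis R n :=
  (p.1 + q.1, p.2 + q.2 + 2^-1 * omega p.1 q.1).

Definition heis_inv {R : realType} {n : nat} (p : heis R n) : heis R n :=
  (- p.1, - p.2).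

Definition koranyi_norm {R : realType} {n : nat} (p : heis R n) : R :=
  (enorm p.1 ^+ 4 + 16 * p.2 ^+ 2) `^ 4^-1.

Definition koranyi_dist {R : realType} {n : nat} (p q : heis R n) : R :=
  koranyi_norm (heis_mul (heis_inv q) p).

Definition heis_dim {R : realType} {n : nat} (A : set (heis R n)) : \bar R :=
  hausdorff_dim koranyi_dist A.

Definition horiz_proj {R : realType} {n : nat} (V : {vspace 'rV[R]_(n + n)})
    (p : heis R n) : heis R n :=
  (orth_proj V p.1, 0).

Definition vert_projL {R : realType} {n : nat} (V : {vspace 'rV[R]_(n + n)})
    (p : heis R n) : heis R n :=
  heis_mul p (heis_inv (horiz_proj V p)).

(* The isotropic Grassmannian G_h(n,m) carries the topology given by the
   distance |pi_V - pi_W| between orthogonal projections.  Measurable types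
   have to be pointed, hence the parameter [m <= n]: it makes the space
   nonempty. *)

Definition isotropic {R : realType} {n : nat} (V : {vspace 'rV[R]_(n + n)})
    : bool :=
  `[< forall z w, z \in V -> w \in V -> omega z w = 0 >].

Definition isoGrass (R : realType) (n m : nat) (hmn : (m <= n)%N) :=
  {V : {vspace 'rV[R]_(n + n)} | isotropic V && (\dim V == m)}.

Definition proj_mx_of {R : realType} {n m : nat} {hmn : (m <= n)%N}
    (V : isoGrass R hmn) : 'M[R]_(n + n) :=
  lin1_mx (orth_proj (val V)).

Definition std_isoV (R : realType) (n m : nat) : {vspace 'rV[R]_(n + n)} :=
  limg (linfun (mulmxr (row_mx (pid_mx m) 0 : 'M[R]_(m, n + n)))).

Lemma std_isotropic (R : realType) (n m : nat) (hmn : (m <= n)%N) :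
  isotropic (std_isoV R n m) && (\dim (std_isoV R n m) == m).
Proof.
apply/andP; split.
  apply/asboolP => _ _ /memv_imgP[u _ ->] /memv_imgP[v _ ->].
  rewrite !lfunE /= !mul_mx_row !mulmx0 /omega big1// => j _.
  by rewrite !row_mxKl !row_mxKr !mxE mulr0 mul0r subr0.
rewrite limg_dim_eq; first by rewrite dimvf /dim /= mul1n.
apply/eqP; rewrite capfv -subv0; apply/subvP => u.
rewrite memv_ker lfunE /= mul_mx_row -row_mx0 memv0 => /eqP.
move=> /eq_row_mx[u0 _]; apply/eqP.
have := congr1 (mulmxr (pid_mx m : 'M[R]_(n, m))) u0.
by rewrite /= mul0mx -mulmxA mul_pid_mx minnn (minn_idPr hmn) pid_mx_1 mulmx1.
Qed.

HB.instance Definition _ (R : realType) (n m : nat) (hmn : (m <= n)%N) :=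
  SubChoice.on (isoGrass R hmn).
HB.instance Definition _ (R : realType) (n m : nat) (hmn : (m <= n)%N) :=
  isPointed.Build (isoGrass R hmn)
    (exist (fun V => isotropic V && (\dim V == m)) (std_isoV R n m)
      (std_isotropic R hmn)).
HB.instance Definition _ (R : realType) (n m : nat) (hmn : (m <= n)%N) :=
  Topological.copy (isoGrass R hmn)
    (initial_topology (@proj_mx_of R n m hmn)).

(* R^2n = C^n via z = x + iy; unitary matrices act on row vectors from the
   right. *)

Definition unitaryG (R : realType) (n : nat) :=
  {U : 'M[R[i]]_n | U \is unitarymx}.

Definition toC {R : realType} {n : nat} (z : 'rV[R]_(n + n)) : 'rV[R[i]]_n :=
  \row_j Complex (lsubmx z 0 j) (rsubmx z 0 j).

Definition ofC {R : realType} {n : nat} (c : 'rV[R[i]]_n) : 'rV[R]_(n + n) :=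
  row_mx (map_mx (@complex.Re R) c) (map_mx (@complex.Im R) c).

Definition unitary_map {R : realType} {n : nat} (U : unitaryG R n)
    (z : 'rV[R]_(n + n)) : 'rV[R]_(n + n) :=
  ofC (toC z *m val U).

Lemma toC_linear {R : realType} {n : nat} (a : R) (z w : 'rV[R]_(n + n)) :
  toC (a *: z + w) = (a%:C)%C *: toC z + toC w.
Proof.
apply/rowP => j; rewrite !mxE; apply/eqP; rewrite eq_complex /=.
by rewrite !mul0r subr0 addr0 !eqxx.
Qed.

Lemma ofC_linear {R : realType} {n : nat} (a : R) (c d : 'rV[R[i]]_n) :
  ofC ((a%:C)%C *: c + d) = a *: ofC c + ofC d.
Proof.
rewrite /ofC scale_row_mx add_row_mx; congr row_mx; apply/rowP => j;
  rewrite !mxE; case: (c 0 j) (d 0 j) => [c1 c2] [d1 d2] /=;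
  by rewrite mul0r ?subr0 ?addr0.
Qed.

Lemma toCK {R : realType} {n : nat} : cancel (@toC R n) ofC.
Proof.
move=> z; rewrite -[RHS]hsubmxK /ofC; congr row_mx;
  by apply/rowP => j; rewrite !mxE.
Qed.

Lemma ofCK {R : realType} {n : nat} : cancel (@ofC R n) toC.
Proof.
move=> c; apply/rowP => j; rewrite mxE /ofC row_mxKl row_mxKr !mxE.
by case: (c 0 j).
Qed.

Lemma unitary_map_is_linear {R : realType} {n : nat} (U : unitaryG R n) :
  linear (unitary_map U).
Proof.
move=> a z w.
by rewrite /unitary_map toC_linear mulmxDl -scalemxAl ofC_linear.
Qed.

HB.instance Definition _ (R : realType) (n : nat) (U : unitaryG R n) :=
  GRing.isLinear.Build R 'rV[R]_(n + n) 'rV[R]_(n + n) _ (unitary_map U)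
    (unitary_map_is_linear U).

Lemma omega_toC {R : realType} {n : nat} (z w : 'rV[R]_(n + n)) :
  omega z w = complex.Im ((toC w *m (toC z)^t*%sesqui) 0 0).
Proof.
rewrite !mxE /omega (raddf_sum (@complex.Im R)).
apply: eq_bigr => j _; rewrite !mxE /=.
by rewrite mulrN [RHS]addrC; congr (_ - _); exact: mulrC.
Qed.

Lemma omega_unitary {R : realType} {n : nat} (U : unitaryG R n)
    (z w : 'rV[R]_(n + n)) :
  omega (unitary_map U z) (unitary_map U w) = omega z w.
Proof.
rewrite !omega_toC !ofCK trmx_mul map_mxM mulmxA -[_ *m val U *m _]mulmxA.
by rewrite (unitarymxP (valP U)) mulmx1.
Qed.

Lemma unitary_map_inj {R : realType} {n : nat} (U : unitaryG R n) :
  injective (unitary_map U).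
Proof.
move=> z w /(can_inj ofCK) /(congr1 (mulmxr (invmx (val U)))) /=.
by rewrite !mulmxK ?unitarymx_unit ?(valP U)// => /(can_inj toCK).
Qed.

Lemma unitary_isoGrass {R : realType} {n m : nat} {hmn : (m <= n)%N}
    (U : unitaryG R n) (V : isoGrass R hmn) :
  let W := (linfun (unitary_map U) @: val V)%VS in
  isotropic W && (\dim W == m).
Proof.
case: V => V /= /andP[/asboolP isoV /eqP dimV]; apply/andP; split.
  apply/asboolP => _ _ /memv_imgP[z zV ->] /memv_imgP[w wV ->].
  by rewrite !lfunE /= omega_unitary isoV.
rewrite limg_dim_eq ?dimV//; apply/eqP; rewrite -subv0; apply/subvP => z.
rewrite memv_cap memv_ker lfunE memv0 /= => /andP[_ /eqP Uz0].
by apply/eqP/(@unitary_map_inj _ _ U); rewrite Uz0 linear0.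
Qed.

Definition unitary_act {R : realType} {n m : nat} {hmn : (m <= n)%N}
    (U : unitaryG R n) (V : isoGrass R hmn) : isoGrass R hmn :=
  exist (fun W => isotropic W && (\dim W == m)) _ (unitary_isoGrass U V).

(* mu_{n,m} is the unique Borel probability measure on the isotropic
   Grassmannian satisfying this. *)
Definition unitary_invariant {R : realType} {n m : nat} {hmn : (m <= n)%N}
    (mu : set (borelType (isoGrass R hmn)) -> \bar R) :=
  forall (U : unitaryG R n) (B : set (borelType (isoGrass R hmn))),
    measurable B -> mu (unitary_act U @^-1` B) = mu B.

(* Main.v *)
(** On bounded sets the Koranyi distance dominates a multiple of the Euclidean
    one, so the Koranyi dimension of a projection is at least its Euclidean
    dimension; and since a Euclidean cube of side [2^-k] splits into about [2^k]
    pieces of Koranyi diameter [2^-k], the Euclidean dimension of [A] is at least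
    [dim A - 1]. It remains to prove a Marstrand type theorem for the maps
    [vert_projL V] in the Euclidean metric.

    Euclidean side: if [z - w] is not small compared with [p - q], where
    [p = (z, t)] and [q = (w, s)], then the planes with
    [|pi_{V^perp} (z - w)| <= r] have measure at most
    [C (r / |z - w|)^(2n - m)]; if it is small, the vertical components keep the
    projections of [p] and [q] apart for every [V]. The measure estimate only
    uses invariance: all vectors of the same length are equally likely to be
    near [V], and among the [N^(2n)] integer points of a cube of side [N] only
    [O(N^m)] are near an m-dimensional space.

    A Borel set is Suslin, and the dyadic net content is continuous along
    increasing sequences, so the sequences parametrizing [A] can be bounded
    without losing content. This yields finite measures of Frostman type,
    supported by the successive approximations of a compact subset of [A]. Their
    energies have bounded integral over the planes, so by Fatou's lemma they are
    bounded along a subsequence for almost every plane, which forbids covers of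
    the projection with small sums. *)

Require Import Defs.
From mathcomp Require Import all_boot all_order all_algebra.
From mathcomp Require Import complex.
From mathcomp Require Import all_classical all_reals all_analysis.
From mathcomp Require Import measurable_realfun.
From mathcomp Require Import zify ring lra.
Import Order.TTheory GRing.Theory Num.Theory.
Import numFieldNormedType.Exports.
Set Implicit Arguments.
Unset Strict Implicit.
Unset Printing Implicit Defensive.
Local Open Scope classical_set_scope.
Local Open Scope ring_scope.

(** * Dyadic net content *)

Section SumBounds.
Context {R : realType}.

(** No measure on the Heisenberg group is constructed and no weak limit is taken. A finite list of
    weighted points stands for a measure obeying the Frostman bound down to level k only. Its energy
    is a finite sum over scales and pairs of points, so its mean over the planes is a finite sum of
    probabilities of explicit closed sets of planes. The price is that a cover of the projection
    must be compared with lists that vary with k. Every list lies in A, so the cover catches it at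
    once; but the energy of the k-th list sees only scales down to 2^-k, so finitely many members,
    chosen before k, have to catch all later lists. This is where the compactness hidden in the
    bounded sequences enters. Three exponents t < s < 2n - m occur: the content of A is positive at
    s, energies are summed at t, planes are measured at 2n - m. The two strict gaps make two
    geometric series converge, and the second one caps the conclusion at 2n - m. Positive content at
    s is what dim A > s + 1 provides, so t can approach dim A - 1. *)

Definition sum_le {I : eqType} (w : I -> R) (D : set I) (e : R) :=
  forall l : seq I, uniq l -> (forall u, u \in l -> D u) -> \sum_(u <- l) w u <= e.

Lemma sum_le_ge0 {I : eqType} (w : I -> R) D e : sum_le w D e -> 0 <= e.
Proof. by move=> /(_ [::] isT); rewrite big_nil; apply. Qed.

Lemma sum_leW {I : eqType} (w : I -> R) (D D' : set I) e e' :
  D' `<=` D -> e <= e' -> sum_le w D e -> sum_le w D' e'.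
Proof.
move=> DD ee h l ul lD; apply: le_trans ee; apply: h => // u /lD; exact: DD.
Qed.

(** The sets may overlap, so each index of the list is charged to one chosen [j]; regrouping by that
    choice bounds every group separately. *)
Lemma sum_le_bigcup {I J : eqType} (w : I -> R) (P : set J) (D : J -> set I)
    (f : J -> R) e :
  (forall j, P j -> sum_le w (D j) (f j)) -> sum_le f P e ->
  sum_le w (\bigcup_(j in P) D j) e.
Proof.
move=> wf fe l ul lD.
have [->|] := eqVneq l [::].
  by rewrite big_nil; exact: (sum_le_ge0 fe).
case: l ul lD => // u0 l0 ul lD _; have [j0 _ _] := lD u0 (mem_head _ _).
move: (u0 :: l0) ul lD => {u0 l0} l ul lD.
have /boolp.choice[g gP] (u : I) : exists j, u \in l -> P j /\ D j u.
  by have [/lD[j Pj Dj]|] := boolP (u \in l); [exists j|exists j0].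
pose r := undup (map g l).
have -> : \sum_(u <- l) w u = \sum_(u <- l) \sum_(j <- r | j == g u) w u.
  apply: eq_big_seq => u ul'.
  rewrite -big_filter filter_pred1_uniq ?undup_uniq ?big_seq1//.
  by rewrite mem_undup; apply/mapP; exists u.
rewrite (exchange_big_dep predT)//=.
apply: le_trans (fe r (undup_uniq _) _); last first.
  by move=> j; rewrite mem_undup => /mapP[u /gP[Pj _] ->].
rewrite big_seq [leRHS]big_seq; apply: ler_sum => j.
rewrite mem_undup => /mapP[u /gP[Pj _] jE].
rewrite -big_filter; apply: wf; rewrite ?jE// ?filter_uniq// => v.
by rewrite mem_filter => /andP[/eqP -> /gP[]].
Qed.

Lemma sum_uniq_le (f : nat -> R) (l : seq nat) : (forall n, 0 <= f n) -> uniq l ->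
  \sum_(i <- l) f i <= \sum_(0 <= i < (\max_(i <- l) i).+1) f i.
Proof.
move=> f0 ul; rewrite /index_iota subn0.
have : {subset l <= iota 0 (\max_(i <- l) i).+1}.
  by move=> i il; rewrite mem_iota /= add0n ltnS; apply: leq_bigmax_seq.
move: (iota _ _) (iota_uniq 0 (\max_(i <- l) i).+1) => s us ls.
have /(perm_big _)-> : perm_eq s (l ++ [seq x <- s | x \notin l]).
  apply: uniq_perm => //.
    rewrite cat_uniq ul filter_uniq// andbT -all_predC; apply/allP => x.
    by rewrite mem_filter => /andP[].
  move=> x; rewrite mem_cat mem_filter.
  by case: (boolP (x \in l)) => // /ls ->.
by rewrite big_cat /= lerDl; apply: sumr_ge0.
Qed.

Lemma sum_half_le (P : set nat) (e : R) : 0 <= e ->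
  sum_le (fun n => e * 2^-1 ^+ n.+1) P e.
Proof.
move=> e0 l ul _.
apply: le_trans (sum_uniq_le (f := fun n => e * 2^-1 ^+ n.+1) _ ul) _.
  by move=> n; rewrite mulr_ge0// exprn_ge0.
rewrite -mulr_sumr ler_piMr//.
elim: (_.+1) => [|k IH]; first by rewrite big_geq.
have -> : \sum_(0 <= i < k.+1) (2^-1 : R) ^+ i.+1 = 1 - 2^-1 ^+ k.+1.
  elim: k {IH} => [|k IH]; first by rewrite big_nat1 expr1; lra.
  by rewrite big_nat_recr//= IH (exprS _ k.+1); lra.
by rewrite gerBl exprn_ge0.
Qed.

End SumBounds.

Section TreeContent.
Context {R : realType} {X : eqType} (code : X -> nat -> bool) (lam : R).
Hypothesis lam01 : 0 < lam < 1.

Let lam0 : 0 < lam. Proof. by case/andP: lam01. Qed.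
Let lam1 : lam < 1. Proof. by case/andP: lam01. Qed.

Definition cell (u : seq bool) : set X :=
  [set x | mkseq (code x) (size u) = u].

Definition weight (u : seq bool) : R := lam ^+ size u.

Definition covers (A : set X) (e : R) :=
  exists2 D : set (seq bool), A `<=` \bigcup_(u in D) cell u & sum_le weight D e.

Definition net_content (A : set X) : R := inf [set e | covers A e].

Lemma weight_gt0 u : 0 < weight u. Proof. exact: exprn_gt0. Qed.

Lemma weight_prefix u v : prefix u v -> weight v <= weight u.
Proof.
move=> /prefixP[s ->]; rewrite /weight size_cat exprD ler_piMr ?exprn_ge0 ?(ltW lam0)//.
by apply: exprn_ile1; apply: ltW.
Qed.

Lemma covers_ge0 A e : covers A e -> 0 <= e.
Proof. by case=> D _ /sum_le_ge0. Qed.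

Lemma covers_cell A u : covers (A `&` cell u) (weight u).
Proof.
exists [set u]; first by move=> x [_ ux]; exists u.
case=> [_ _|v [|v' l]]; first by rewrite big_nil ltW// weight_gt0.
  by move=> _ /(_ v (mem_head _ _)) ->; rewrite big_seq1.
move=> /= /andP[]; rewrite inE negb_or => /andP[/eqP + _] _ lu.
rewrite (lu v) ?inE ?eqxx// (lu v') ?inE ?eqxx ?orbT//.
Qed.

Lemma cell_nil : cell [::] = setT.
Proof. by apply/seteqP; split. Qed.

Lemma coversT A : covers A 1.
Proof.
by have := covers_cell A [::]; rewrite cell_nil setIT /weight expr0.
Qed.

Lemma covers_has_inf A : has_inf [set e | covers A e].
Proof.
split; first by exists 1; exact: coversT.
by exists 0 => e; exact: covers_ge0.
Qed.

Lemma net_content_le A e : covers A e -> net_content A <= e.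
Proof. by move=> h; apply: ge_inf => //; case: (covers_has_inf A). Qed.

Lemma net_content_ge0 A : 0 <= net_content A.
Proof.
by apply: lb_le_inf; [case: (covers_has_inf A)|move=> e; exact: covers_ge0].
Qed.

Lemma coversW A B e e' : A `<=` B -> e <= e' -> covers B e -> covers A e'.
Proof.
move=> AB ee [D BD De]; exists D; first by apply: subset_trans BD.
exact: sum_leW De.
Qed.

Lemma net_content_lt A e : net_content A < e -> covers A e.
Proof.
move=> ce; have [f /= fA fe] := inf_lt (covers_has_inf A).1 ce.
by apply: coversW fA => //; exact: ltW.
Qed.

Lemma net_content_mono A B : A `<=` B -> net_content A <= net_content B.
Proof.
move=> AB; apply/ler_addgt0Pr => e e0; apply: net_content_le.
by apply: (@coversW _ B (net_content B + e)) => //; apply: net_content_lt; rewrite ltrDl.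
Qed.

Lemma net_content_cell A u : net_content (A `&` cell u) <= weight u.
Proof. by apply: net_content_le; exact: covers_cell. Qed.

Lemma covers_bigcup {J : eqType} (P : set J) (B : J -> set X) f e :
  (forall j, P j -> covers (B j) (f j)) -> sum_le f P e ->
  covers (\bigcup_(j in P) B j) e.
Proof.
move=> Bf fe.
have /boolp.choice[D DP] (j : J) : exists D : set (seq bool),
    P j -> B j `<=` \bigcup_(u in D) cell u /\ sum_le weight D (f j).
  have [/Bf[D BD Df]|nP] := pselect (P j); first by exists D.
  by exists set0.
exists (\bigcup_(j in P) D j).
  move=> x [j Pj Bx]; have [/(_ x Bx)[u Du ux] _] := DP j Pj.
  by exists u => //; exists j.
by apply: sum_le_bigcup fe => j /DP[].
Qed.

Lemma covers_setU A B e f : covers A e -> covers B f -> covers (A `|` B) (e + f).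
Proof.
move=> [D AD De] [E BE Ef]; exists (D `|` E).
  by move=> x [/AD[u Du ux]|/BE[u Eu ux]]; exists u => //; [left|right].
move=> l ul lDE; rewrite (bigID (fun u => `[< D u >])) /=; apply: lerD.
  rewrite -big_filter; apply: De; rewrite ?filter_uniq// => u.
  by rewrite mem_filter => /andP[/asboolP].
rewrite -big_filter; apply: Ef; rewrite ?filter_uniq// => u.
by rewrite mem_filter => /andP[/asboolPn nD /lDE[]].
Qed.

Lemma net_content_setU A B : net_content (A `|` B) <= net_content A + net_content B.
Proof.
apply/ler_addgt0Pr => e e0; apply: net_content_le.
apply: (@coversW _ (A `|` B) ((net_content A + e / 2) + (net_content B + e / 2))) => //.
  by lra.
by apply: covers_setU; apply: net_content_lt; lra.
Qed.

Lemma cell_rcons u : cell u = cell (rcons u false) `|` cell (rcons u true).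
Proof.
apply/seteqP; split=> x; rewrite /cell /= !size_rcons !mkseqS.
  by move=> ->; case: (code x _); [right|left].
by move=> [] /rcons_inj[].
Qed.

Lemma cell_prefix u v : prefix u v -> cell v `<=` cell u.
Proof.
move=> /prefixP[s ->] x; rewrite /cell /= size_cat => /(congr1 (take (size u))).
by rewrite take_size_cat// /mkseq -map_take take_iota (minn_idPl (leq_addr _ _)).
Qed.

Lemma cell_comparable u v x : (size u <= size v)%N -> cell u x -> cell v x ->
  prefix u v.
Proof.
rewrite /cell /= => uv ux vx; rewrite prefixE -{1}vx -[X in _ == X]ux.
by rewrite /mkseq -map_take take_iota (minn_idPl uv).
Qed.

(** A cover costing less than [weight u] contains no cell at or above [u], since those weigh at
    least as much. Every cell it needs lies below one child, and it separates into covers of the two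
    halves. *)
Lemma net_content_split A u : net_content (A `&` cell u) < weight u ->
  net_content (A `&` cell (rcons u false)) + net_content (A `&` cell (rcons u true))
  <= net_content (A `&` cell u).
Proof.
move=> cu; apply/ler_addgt0Pr => e0 e0_gt0.
pose e := Num.min (net_content (A `&` cell u) + e0)
  ((net_content (A `&` cell u) + weight u) / 2).
have ce : net_content (A `&` cell u) < e by rewrite lt_min; apply/andP; split; lra.
apply: (@le_trans _ _ e); last by rewrite ge_min lexx.
have eu : e < weight u by rewrite gt_min; apply/orP; right; lra.
have [D AD De] := net_content_lt ce.
pose E b := [set v | D v /\ prefix (rcons u b) v].
have cE b : A `&` cell (rcons u b) `<=` \bigcup_(v in E b) cell v.
  move=> x [Ax ux]; have : (A `&` cell u) x.
    by split=> //; apply: (cell_prefix (prefix_rcons u b)).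
  move=> /AD[v Dv vx]; exists v => //; split=> //.
  have [|vu] := leqP (size u).+1 (size v).
    by rewrite -(size_rcons u b) => /cell_comparable h; exact: h ux vx.
  have /weight_prefix : prefix v u.
    apply: (@cell_comparable _ _ x) => //.
    exact: (cell_prefix (prefix_rcons u b)).
  have := De [:: v] isT; rewrite big_seq1 => /(_ _) vw uv.
  have : weight v <= e by apply: vw => w; rewrite inE => /eqP ->.
  by move=> /(le_trans uv); rewrite leNgt eu.
have E01 v : E false v -> ~ E true v.
  move=> [_ /prefixP[s ->]] [_]; rewrite cat_rcons prefixE size_rcons -cats1.
  by rewrite take_cat ltnNge leqnSn /= subSnn /= take0 eqseq_cat// eqxx.
apply/ler_addgt0Pr => e1 e1_gt0.
(* The part of the cover below each child may be infinite; its total is the supremum of its finite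
   sums. *)
pose s b := sup [set \sum_(v <- l) weight v | l in
  [set l | uniq l /\ forall v, v \in l -> E b v]].
have sup_ok b : has_sup [set \sum_(v <- l) weight v | l in
    [set l | uniq l /\ forall v, v \in l -> E b v]].
  split; first by exists 0; exists [::] => //; rewrite big_nil.
  by exists e => _ [l [ul lE] <-]; apply: De => // v /lE[].
have sE b : net_content (A `&` cell (rcons u b)) <= s b.
  apply: net_content_le; exists (E b) => // l ul lE.
  by apply: sup_upper_bound => //; exists l.
apply: le_trans (lerD (sE false) (sE true)) _.
have [_ [l0 [ul0 l0E] <-] h0] :=
  sup_adherent (divr_gt0 e1_gt0 (ltr0Sn R 1)) (sup_ok false).
have [_ [l1 [ul1 l1E] <-] h1] :=
  sup_adherent (divr_gt0 e1_gt0 (ltr0Sn R 1)) (sup_ok true).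
have : \sum_(v <- l0 ++ l1) weight v <= e.
  apply: De => [|v]; last by rewrite mem_cat => /orP[/l0E[]|/l1E[]].
  rewrite cat_uniq ul0 ul1 andbT -all_predC; apply/allP => v /= /l1E vt.
  by apply/negP => /l0E /E01.
rewrite big_cat /= -/(s false) -/(s true) in h0 h1 *; lra.
Qed.


Lemma net_content_null_bigcup (A : nat -> set X) :
  (forall n, net_content (A n) <= 0) -> net_content (\bigcup_n A n) <= 0.
Proof.
move=> A0; apply/ler_addgt0Pr => e e0; rewrite add0r; apply: net_content_le.
apply: (covers_bigcup (f := fun n => e * 2^-1 ^+ n.+1)).
  move=> n _; apply: net_content_lt; apply: le_lt_trans (A0 n) _.
  by rewrite mulr_gt0// exprn_gt0.
by apply: sum_half_le; exact: ltW.
Qed.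

Section Increasing.
Variables (A : nat -> set X) (incA : forall n, A n `<=` A n.+1).
Variables (eps : R) (eps01 : 0 < eps < 1).

Let h u := sup [set net_content (A n `&` cell u) | n in setT].

Let A_homo : {homo A : n k / (n <= k)%N >-> n `<=` k}.
Proof.
move=> n k nk; rewrite -(subnK nk); elim: (k - n)%N => [//|i IH].
by rewrite addSn; apply: subset_trans IH _.
Qed.

Let h_ub u : has_sup [set net_content (A n `&` cell u) | n in setT].
Proof.
split; first by exists (net_content (A 0%N `&` cell u)); exists 0%N.
by exists (weight u) => _ [n _ <-]; exact: net_content_cell.
Qed.

Let h_ge n u : net_content (A n `&` cell u) <= h u.
Proof. by apply: sup_upper_bound => //; exists n. Qed.

Let h_le u e : (forall n, net_content (A n `&` cell u) <= e) -> h u <= e.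
Proof. by move=> he; apply: ge_sup; [case: (h_ub u)|move=> _ [n _ <-]]. Qed.

Let h_split u : h u < weight u -> h (rcons u false) + h (rcons u true) <= h u.
Proof.
move=> hu; rewrite -lerBrDr; apply: h_le => n; rewrite lerBrDr addrC -lerBrDr.
apply: h_le => k; rewrite lerBrDr.
apply: le_trans (h_ge (maxn n k) u).
apply: le_trans (net_content_split _); last exact: le_lt_trans (h_ge _ _) hu.
by rewrite addrC; apply: lerD; apply: net_content_mono; apply: setSI; apply: A_homo;
  rewrite ?leq_maxl ?leq_maxr.
Qed.

Let almost_full u := (1 - eps) * weight u <= h u.

Let maximal_full : set (seq bool) := [set u | almost_full u /\
  forall v, prefix v u -> v != u -> ~~ almost_full v].

Let maximal_full_sum1 (l : seq (seq bool)) u : uniq l -> u \in l ->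
  (forall v, v \in l -> maximal_full v /\ prefix u v) -> \sum_(v <- l) h v = h u.
Proof.
move=> ul uin lF; suff lu : perm_eq l [:: u] by rewrite (perm_big _ lu) big_seq1.
apply: uniq_perm => // v; rewrite inE; apply/idP/eqP => [vl|->//].
have [[_ nf] uv] := lF v vl; have [[fu _] _] := lF u uin.
apply/eqP; rewrite eq_sym; apply/negPn/negP => vu.
by have := nf u uv vu; rewrite fu.
Qed.

Let h_ge0 u : 0 <= h u.
Proof. exact: le_trans (net_content_ge0 _) (h_ge 0%N u). Qed.

(** Induction on the depth. Maximal cells are never nested, so a nonempty list without [u] divides
    between the children of [u]. Then [u] lies strictly above a maximal cell, hence is not almost
    full, and [h_split] applies. *)
Let maximal_full_sum k (l : seq (seq bool)) u : uniq l ->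
  (forall v, v \in l -> [/\ maximal_full v, prefix u v & (size v <= size u + k)%N]) ->
  \sum_(v <- l) h v <= h u.
Proof.
elim: k l u => [|k IH] l u ul lF; have [uin|uout] := boolP (u \in l).
- by rewrite (@maximal_full_sum1 l u)// => v /lF[].
- case: l ul lF uout => [_ _ _|v l _ lF]; first by rewrite big_nil; exact: h_ge0.
  have [_ uv] := lF v (mem_head _ _); rewrite addn0 => vu.
  rewrite inE negb_or => /andP[/eqP []]; apply/eqP; move: uv.
  by rewrite prefixE take_oversize// eq_sym.
- by rewrite (@maximal_full_sum1 l u)// => v /lF[].
case: (eqVneq l [::]) => [->|l0]; first by rewrite big_nil; exact: h_ge0.
have lstep v : v \in l -> prefix (rcons u false) v || prefix (rcons u true) v.
  move=> vl; have [_ uv _] := lF v vl; move: uv => /prefixP[[|b s] vE].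
    by move: vl uout; rewrite vE cats0 => ->.
  by rewrite vE -!cat_rcons; case: b {vE}; rewrite prefix_prefix ?orbT.
have nfu : h u < weight u.
  case: l l0 lF uout {ul lstep} => // v l _ lF.
  have [[_ /(_ u) h1] uv _] := lF v (mem_head _ _).
  rewrite inE negb_or => /andP[uv' _]; move: (h1 uv uv').
  rewrite /almost_full -ltNge => /lt_le_trans; apply.
  by rewrite ler_piMl ?(ltW (weight_gt0 _))//; case/andP: eps01 => *; lra.
apply: le_trans (h_split nfu).
rewrite (bigID (prefix (rcons u false))) /=; apply: lerD.
  rewrite -big_filter; apply: IH; first exact: filter_uniq.
  move=> v; rewrite mem_filter => /andP[uv /lF[Fv _ vk]].
  by rewrite size_rcons addSnnS.
rewrite -big_filter; apply: IH; first exact: filter_uniq.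
move=> v; rewrite mem_filter => /andP[uv vl]; have [Fv _ vk] := lF v vl.
split=> //; last by rewrite size_rcons addSnnS.
by move: (lstep v vl); rewrite (negbTE uv).
Qed.

Let full_covers a : (forall n, net_content (A n) <= a) ->
  covers (\bigcup_(u in maximal_full) cell u) (a / (1 - eps)).
Proof.
have e1 : 0 < 1 - eps by case/andP: eps01 => *; lra.
move=> Aa; exists maximal_full => // l ul lF.
rewrite ler_pdivlMr// mulr_suml.
apply: (@le_trans _ _ (\sum_(v <- l) h v)).
  rewrite big_seq [leRHS]big_seq; apply: ler_sum => v /lF[+ _].
  by rewrite /almost_full mulrC.
apply: (@le_trans _ _ (h [::])).
  apply: (maximal_full_sum (k := \max_(v <- l) size v)) => // v vl; split.
  - exact: lF.
  - exact: prefix0s.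
  - by rewrite add0n; apply: leq_bigmax_seq.
by apply: h_le => n; rewrite cell_nil setIT.
Qed.

Let not_full x u : (~` \bigcup_(v in maximal_full) cell v) x -> cell u x ->
  ~~ almost_full u.
Proof.
move=> xF ux; apply/negP => fu.
have ex : exists k, almost_full (take k u) by exists (size u); rewrite take_size.
case: (ex_minnP ex) => k fk kmin; apply: xF; exists (take k u).
  split=> // v vk vneq; apply/negP => fv.
  have kv : (size v < k)%N.
    have := size_prefix vk; rewrite leq_eqVlt => /orP[/eqP sv|].
      move: vk vneq; rewrite prefixE sv take_size => /eqP ->; by rewrite eqxx.
    by move=> /leq_trans; apply; rewrite size_take_min geq_minl.
  have vE : take (size v) u = v.
    move: vk; rewrite prefixE => /eqP; rewrite take_takel// ltnW//.
  by have := kmin (size v); rewrite vE => /(_ fv); rewrite leqNgt kv.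
exact: cell_prefix (prefix_take _ _) _ ux.
Qed.

(** The content c of the rest satisfies c <= (1 - eps) c: in each cell of a nearly optimal cover
    that meets the rest, [A n] has content below 1 - eps times the weight, so the cell can be
    replaced by a cheaper cover. *)
Let net_content_rest n :
  net_content (A n `\` \bigcup_(v in maximal_full) cell v) <= 0.
Proof.
set B := A n `\` _; have e1 : 0 < eps by case/andP: eps01.
suff : net_content B <= (1 - eps) * net_content B by have := net_content_ge0 B; nra.
apply/ler_addgt0Pr => e e0.
apply: (@le_trans _ _ ((1 - eps) * (net_content B + e))); last first.
  by rewrite mulrDr lerD2l ler_piMl ?ltW//; lra.
have [D BD De] : covers B (net_content B + e) by apply: net_content_lt; rewrite ltrDl.
apply: net_content_le.
apply: (@coversW _ (\bigcup_(u in [set u | D u /\ (B `&` cell u) !=set0]) (B `&` cell u))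
  ((1 - eps) * (net_content B + e))) => //.
  by move=> x Bx; have [u Du ux] := BD x Bx; exists u => //; split=> //; exists x.
apply: (covers_bigcup (f := fun u => (1 - eps) * weight u)).
  move=> u [Du [x [Bx ux]]]; apply: net_content_lt.
  apply: le_lt_trans (net_content_mono (B := A n `&` cell u) _) _.
    by apply: setSI => y [].
  apply: le_lt_trans (h_ge n u) _; rewrite ltNge.
  by apply: not_full ux; case: Bx.
move=> l ul lD; rewrite -mulr_sumr ler_wpM2l//; first by case/andP: eps01 => *; lra.
by apply: De => // u /lD[].
Qed.

Lemma net_content_bigcup_eps a : (forall n, net_content (A n) <= a) ->
  net_content (\bigcup_n A n) <= a / (1 - eps).
Proof.
move=> /full_covers /net_content_le Fa.
rewrite -[leRHS]addr0; set F := \bigcup_(u in maximal_full) cell u in Fa.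
apply: (@le_trans _ _ (net_content (F `|` \bigcup_n (A n `\` F)))).
  apply: net_content_mono => x [n _ Ax]; have [xF|xF] := pselect (F x); [by left|].
  by right; exists n.
apply: le_trans (net_content_setU _ _) _; apply: lerD => //.
by apply: net_content_null_bigcup; exact: net_content_rest.
Qed.

End Increasing.

(* Cover by the maximal cells that the sets A n eventually fill up to a factor
   1 - eps: in every cell around the remaining points the content stays below
   (1 - eps) times the weight, which makes the rest of each A n a null set. *)
Lemma net_content_bigcup (A : nat -> set X) a : (forall n, A n `<=` A n.+1) ->
  a < net_content (\bigcup_n A n) -> exists n, a < net_content (A n).
Proof.
move=> incA aA; apply: contrapT => /forallNP nA.
have Aa n : net_content (A n) <= a by rewrite leNgt; apply/negP; exact: nA.
move: aA; apply/negP; rewrite -leNgt.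
have a0 : 0 <= a := le_trans (net_content_ge0 _) (Aa 0%N).
apply/ler_addgt0Pr => e e0.
(* This choice makes a / (1 - eps) equal to a + a e / (1 + a), which is at most a + e. *)
have eps01 : 0 < e / (1 + a + e) < 1.
  by rewrite divr_gt0 ?ltr_pdivrMr ?mul1r//=; lra.
apply: le_trans (net_content_bigcup_eps incA eps01 Aa) _.
have -> : 1 - e / (1 + a + e) = (1 + a) / (1 + a + e) by field; lra.
by rewrite invf_div mulrA ler_pdivrMr; nra.
Qed.


(** Lists of pairs (mass, point) play the role of finitely supported measures throughout. *)
Definition mass (L : seq (R * X)) (B : set X) : R :=
  \sum_(p <- L | `[< B p.2 >]) p.1.

Lemma mass_cat L L' B : mass (L ++ L') B = mass L B + mass L' B.
Proof. by rewrite /mass big_cat. Qed.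

Lemma mass_out L B C : (forall p, p \in L -> B p.2) -> B `&` C = set0 ->
  mass L C = 0.
Proof.
move=> LB BC; rewrite /mass big_seq_cond big1// => p /andP[/LB Bp /asboolP Cp].
by have : (B `&` C) p.2 by []; rewrite BC.
Qed.

Lemma mass_le L B : (forall p, p \in L -> 0 <= p.1) ->
  mass L B <= \sum_(p <- L) p.1.
Proof.
move=> L0; rewrite /mass [leRHS](bigID (fun p => `[< B p.2 >])) /= lerDl.
by rewrite big_seq_cond; apply: sumr_ge0 => p /andP[/L0].
Qed.

(* Splitting the prescribed mass among the two children of a cell works at every
   level because the content of the cell is at most the sum of theirs. *)
Lemma frostman_list A j u m : 0 <= m <= net_content (A `&` cell u) ->
  exists L : seq (R * X),
    [/\ \sum_(p <- L) p.1 = m,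
        forall p, p \in L -> [/\ 0 <= p.1, A p.2 & cell u p.2] &
        forall v, (size u <= size v <= size u + j)%N ->
          mass L (cell v) <= weight v].
Proof.
elim: j u m => [|j IH] u m /andP[m0 mc].
  have [E|/set0P[x [Ax ux]]] := eqVneq (A `&` cell u) set0; last first.
    exists [:: (m, x)]; split.
    - by rewrite big_seq1.
    - by move=> p; rewrite inE => /eqP ->.
    move=> v; rewrite addn0 -eqn_leq => /eqP suv.
    apply: le_trans (mass_le _ _) _; first by move=> p; rewrite inE => /eqP ->.
    rewrite big_seq1 /weight -suv; apply: le_trans mc _; exact: net_content_cell.
  exists [::]; split=> //; last first.
    by move=> v _; rewrite /mass big_nil ltW// weight_gt0.
  rewrite big_nil; apply/le_anti; rewrite m0 andTb.
  apply: le_trans mc _; rewrite E; apply: net_content_le; exists set0 => //.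
  by case=> [|v l] _ h; [rewrite big_nil|have := h v (mem_head _ _)].
have mw : m <= weight u := le_trans mc (net_content_cell _ _).
pose c b := net_content (A `&` cell (rcons u b)).
have mc2 : m <= c false + c true.
  by apply: le_trans mc _; rewrite cell_rcons setIUr; exact: net_content_setU.
have c0 b : 0 <= c b := net_content_ge0 _.
(* The first child takes as much as its content allows; the remainder fits in the second, because
   [m] is at most the sum of the two contents. *)
pose m0' := Num.min m (c false).
have m00 : 0 <= m0' by rewrite le_min m0 c0.
have m0c : m0' <= c false by rewrite ge_min lexx orbT.
have m1c : m - m0' <= c true.
  by have := c0 true; rewrite /m0' minEle; case: ifP => _; lra.
have m10 : 0 <= m - m0' by rewrite subr_ge0 ge_min lexx.
have [|L0 [L0m L0A L0v]] := IH (rcons u false) m0'; first by rewrite m00 m0c.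
have [|L1 [L1m L1A L1v]] := IH (rcons u true) (m - m0'); first by rewrite m10 m1c.
have LA p : p \in L0 ++ L1 -> [/\ 0 <= p.1, A p.2 & cell u p.2].
  rewrite mem_cat => /orP[/L0A|/L1A] [? ? uv]; split=> //;
  exact: cell_prefix (prefix_rcons u _) _ uv.
exists (L0 ++ L1); split => //.
  by rewrite big_cat /= L0m L1m addrC subrK.
move=> v /andP[]; rewrite leq_eqVlt => /orP[/eqP suv _|uv vj].
  apply: le_trans (mass_le _ _) _; first by move=> p /LA[].
  by rewrite big_cat /= L0m L1m addrC subrK /weight -suv.
have out b L : (forall p, p \in L -> [/\ 0 <= p.1, A p.2 & cell (rcons u b) p.2]) ->
    ~~ prefix (rcons u b) v -> mass L (cell v) = 0.
  move=> LA' nuv; apply: (@mass_out _ (cell (rcons u b))); first by move=> p /LA'[].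
  apply/eqP; apply: contraNT nuv => /set0P[x [ux vx]].
  by apply: cell_comparable ux vx; rewrite size_rcons.
have lev b : (size (rcons u b) <= size v <= size (rcons u b) + j)%N.
  by rewrite size_rcons uv addSnnS.
rewrite mass_cat; have [uv0|uv0] := boolP (prefix (rcons u false) v).
  rewrite (out true L1)// ?addr0 ?L0v//; apply/negP.
  move: uv0; rewrite !prefixE !size_rcons => /eqP ->.
  by rewrite eqseq_rcons andbF.
by rewrite (out false L0)// add0r L1v.
Qed.

End TreeContent.

(** * Suslin sets *)

Section Suslin.
Context {X : topologicalType}.
Implicit Types (C : X -> (nat -> nat) -> Prop) (s : nat -> nat).

Definition agree k s s' := forall i, (i < k)%N -> s' i = s i.

Definition slice C s k : set X := [set x | exists2 s', agree k s s' & C x s'].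

(* C is a closed subset of the product of X with the Baire space. *)
Definition sclosed C := forall x s, (forall k, closure (slice C s k) x) -> C x s.

Definition suslin (A : set X) := exists2 C, sclosed C & A = [set x | exists s, C x s].

Lemma suslin_closed F : closed F -> suslin F.
Proof.
move=> cF; exists (fun x _ => F x).
  by move=> x s /(_ 0%N) h; apply: cF; apply: closureS h => y [].
by apply/seteqP; split=> [x Fx|x []//]; exists (fun=> 0%N).
Qed.

Lemma suslin_bigcup (A : nat -> set X) : (forall n, suslin (A n)) ->
  suslin (\bigcup_n A n).
Proof.
move=> sA.
have /boolp.choice[C CP] n : exists C, sclosed C /\ A n = [set x | exists s, C x s].
  by have [C] := sA n; exists C.
exists (fun x s => C (s 0%N) x (fun i => s i.+1)).
  move=> x s h; apply: (CP _).1 => k; apply: closureS (h k.+1) => y [s' ss' Cy].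
  exists (fun i => s' i.+1); first by move=> i ik; exact: ss'.
  by rewrite -(ss' 0%N).
apply/seteqP; split=> [x [n _]|x [s Cx]]; last first.
  by exists (s 0%N) => //; rewrite (CP _).2; exists (fun i => s i.+1).
rewrite (CP _).2 => -[s Cx].
by exists (fun i => if i is j.+1 then s j else n).
Qed.

(** One sequence stores countably many: entry j of the n-th sits at the position coding (n, j). *)
Lemma suslin_bigcap (A : nat -> set X) : (forall n, suslin (A n)) ->
  suslin (\bigcap_n A n).
Proof.
move=> sA.
have /boolp.choice[C CP] n : exists C, sclosed C /\ A n = [set x | exists s, C x s].
  by have [C] := sA n; exists C.
exists (fun x s => forall i, C i x (fun j => s (pickle (i, j)))).
  move=> x s h i; apply: (CP _).1 => k.
  (* A prefix long enough to contain the positions of the first [k] entries of the [i]-th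
     sequence. *)
  apply: closureS (h (\max_(j < k) (pickle (i, nat_of_ord j)).+1)%N) => y [s' ss' Cy].
  exists (fun j => s' (pickle (i, j))) => // j jk; apply: ss'.
  exact: (leq_bigmax (F := fun j : 'I_k => (pickle (i, nat_of_ord j)).+1) (Ordinal jk)).
apply/seteqP; split=> [x Ax|x [s Cx] n _]; last first.
  by rewrite (CP _).2; exists (fun j => s (pickle (n, j))).
have /boolp.choice[s sP] n : exists s, C n x s.
  by have := Ax n I; rewrite (CP _).2.
exists (fun k => if unpickle k is Some p then s p.1 p.2 else 0%N) => i.
rewrite (_ : (fun j => _) = s i)//; apply/funext => j.
by rewrite pickleK.
Qed.

Definition bounded_slice C (b : nat -> nat) k : set X :=
  [set x | exists2 s, (forall i, (i < k)%N -> (s i <= b i)%N) & C x s].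

Lemma not_closure (B : set X) x : ~ closure B x -> \forall y \near x, ~ B y.
Proof.
move=> /existsNP[U /not_implyP[xU BU]]; apply: filterS xU => y Uy By.
by apply: BU; exists y.
Qed.

(** The first [k] entries of [s] survive: points whose sequences start with them and obey the bound
    [b] to any prescribed depth still accumulate at [x]. *)
Let good C b x k s := forall l, closure [set y | exists2 s',
  agree k s s' & (forall i, (i < l)%N -> (s' i <= b i)%N) /\ C y s'] x.

Let upd s k v i := if i == k then v else s i.

(** Entry [k] has only b k + 1 admissible values. If each failed at some depth, then at a depth
    beyond all of these some neighbourhood of [x] would contain no point of the approximating
    set. *)
Let good_step C b x k s : good C b x k s ->
  exists v : nat, good C b x k.+1 (upd s k v).
Proof.
move=> gs; apply: contrapT => /forallNP nv.
have /boolp.choice[l lP] v : exists l, ~ closure [set y | exists2 s',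
    agree k.+1 (upd s k v) s' & (forall i, (i < l)%N -> (s' i <= b i)%N) /\ C y s'] x.
  exact/existsNP/nv.
pose L := maxn k.+1 (\max_(v < (b k).+1) l v).
have : \forall y \near x, forall v : 'I_(b k).+1, ~ exists2 s',
    agree k.+1 (upd s k v) s' & (forall i, (i < l v)%N -> (s' i <= b i)%N) /\ C y s'.
  by apply: filter_forall => v; exact: not_closure (lP v).
move=> /(gs L)[y [[s' ss' [s'L Cy]] ynot]].
have sk : (s' k < (b k).+1)%N by rewrite ltnS s'L// leq_maxl.
apply: (ynot (Ordinal sk)); exists s'; last first.
  split=> // i il; apply: s'L; apply: leq_trans il _; rewrite leq_max; apply/orP; right.
  exact: (leq_bigmax (F := fun v : 'I_(b k).+1 => l v) (Ordinal sk)).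
move=> i; rewrite /upd ltnS leq_eqVlt; case: eqP => [->//|_ /= ik].
exact: ss'.
Qed.

(* Koenig's lemma in place of the compactness of the set of sequences
   dominated by b. *)
Lemma closure_bounded_slice C b x : sclosed C ->
  (forall k, closure (bounded_slice C b k) x) -> exists s, C x s.
Proof.
move=> sC cx.
have /boolp.choice[v vP] (p : nat * (nat -> nat)) :
    exists v, good C b x p.1 p.2 -> good C b x p.1.+1 (upd p.2 p.1 v).
  have [/good_step[v]|] := pselect (good C b x p.1 p.2); last by exists 0%N.
  by exists v.
pose f := fix f k := if k is j.+1 then upd (f j) j (v (j, f j)) else (fun=> 0%N).
have fP k : good C b x k (f k).
  elim: k => [|k IH]; last exact: (vP (k, f k)).
  by move=> l; apply: closureS (cx l) => y [s sb Cy]; exists s.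
pose s k := v (k, f k).
have fs k : agree k (f k) s.
  elim: k => // k IH i; rewrite ltnS leq_eqVlt /= /upd.
  by case: eqP => [->//|_ /= ik]; exact: IH.
exists s; apply: sC => k; apply: closureS (fP k 0%N) => y [s' fs' [_ Cy]].
by exists s' => // i ik; rewrite (fs k)// fs'.
Qed.

End Suslin.

(** [U] is the union of the closures of the sets of points whose ball of radius 1 / (n + 1) lies in
    [U]; each closure stays in [U] because balls are symmetric. *)
Lemma suslin_open {R : realType} {X : pseudoMetricType R} (U : set X) :
  open U -> suslin U.
Proof.
move=> oU; pose F n := [set x : X | ball x n.+1%:R^-1 `<=` U].
have -> : U = \bigcup_n closure (F n).
  apply/seteqP; split=> x.
    move=> Ux; have /nbhs_ballP[e /= e0 eU] := open_nbhs_nbhs (conj oU Ux).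
    have [n ne] : exists n, n.+1%:R^-1 < e.
      by have /ltr_add_invr[n] := e0; rewrite add0r; exists n.
    exists n => //; apply: subset_closure => y xy; apply: eU.
    by apply: le_ball xy; exact: ltW.
  move=> [n _ /(_ (ball x n.+1%:R^-1))].
  case; first by apply: nbhsx_ballx; rewrite invr_gt0 ltr0n.
  by move=> y [Fy xy]; apply: Fy; exact: ball_sym.
by apply: suslin_bigcup => n; apply: suslin_closed; exact: closed_closure.
Qed.

(** Suslin sets need not be stable under complement, so the complement is carried along: the sets
    that are Suslin together with their complement form a sigma-algebra containing the open sets. *)
Lemma suslin_borel {R : realType} {X : pseudoMetricType R} (A : set X) :
  borel A -> suslin A.
Proof.
suff : borel `<=` [set B : set X | suslin B /\ suslin (~` B)] by move=> h /h[].
apply: smallest_sub; last first.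
  move=> U oU; split; first exact: suslin_open.
  by apply: suslin_closed; exact: open_closedC.
split.
- by split; [apply: suslin_closed; exact: closed0|
    rewrite setC0; apply: suslin_closed; exact: closedT].
- by move=> B [sB sCB]; rewrite setTD /= setCK.
move=> B sB; split; first by apply: suslin_bigcup => n; case: (sB n).
by rewrite setC_bigcup; apply: suslin_bigcap => n; case: (sB n).
Qed.

(* Capacitability: the bounds b are chosen one coordinate at a time. *)
Lemma bounded_slice_net_content {R : realType} {X : topologicalType}
    (code : X -> nat -> bool) (lam : R) (C : X -> (nat -> nat) -> Prop) B a :
  0 < lam < 1 ->
  a < net_content code lam ([set x | exists s, C x s] `&` B) ->
  exists b, forall k, a < net_content code lam (bounded_slice C b k `&` B).
Proof.
move=> lam01 aC.
have step k b : a < net_content code lam (bounded_slice C b k `&` B) ->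
    exists v : nat, a < net_content code lam
      (bounded_slice C (fun i => if i == k then v else b i) k.+1 `&` B).
  (* The slices increase with the bound on entry [k], and their union contains the slice that leaves
     this entry free. *)
  move=> abk; apply: (net_content_bigcup lam01).
    move=> n; apply: setSI => x [s sb Cx]; exists s => // i /sb.
    by case: eqP => // _ /leq_trans; apply.
  apply: lt_le_trans abk _; apply: net_content_mono => // x [[s sb Cx] Bx].
  exists (s k) => //; split=> //; exists s => // i; rewrite ltnS leq_eqVlt.
  by case: eqP => [->//|_ /= /sb].
have /boolp.choice[v vP] (p : nat * (nat -> nat)) : exists v,
    a < net_content code lam (bounded_slice C p.2 p.1 `&` B) ->
    a < net_content code lam
      (bounded_slice C (fun i => if i == p.1 then v else p.2 i) p.1.+1 `&` B).
  have [/step[v]|] := boolP (a < net_content code lam (bounded_slice C p.2 p.1 `&` B)).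
    by exists v.
  by exists 0%N.
pose f := fix f k := if k is j.+1 then
  (fun i => if i == j then v (j, f j) else f j i) else (fun=> 0%N).
have fP k : a < net_content code lam (bounded_slice C (f k) k `&` B).
  elim: k => [|k IH]; last exact: (vP (k, f k)).
  apply: lt_le_trans aC _; apply: net_content_mono => //; apply: setSI.
  by move=> x [s Cx]; exists s.
exists (fun k => v (k, f k)) => k.
have fs i : (i < k)%N -> f k i = v (i, f i).
  elim: k => // k IH; rewrite ltnS leq_eqVlt /=.
  by case: eqP => [->//|_ /= /IH].
apply: lt_le_trans (fP k) _; apply: net_content_mono => //; apply: setSI.
by move=> x [s sb Cx]; exists s => // i ik; rewrite -fs// sb.
Qed.

(** * Euclidean geometry *)

Section Euclid.
Context {R : realType} {k : nat}.
Implicit Types (u v w x : 'rV[R]_k) (V : {vspace 'rV[R]_k}).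

Lemma dotvDl u v w : dotv (u + v) w = dotv u w + dotv v w.
Proof. by rewrite -big_split; apply: eq_bigr => j _; rewrite mxE mulrDl. Qed.

Lemma dotvZl (a : R) u w : dotv (a *: u) w = a * dotv u w.
Proof. by rewrite /dotv mulr_sumr; apply: eq_bigr => j _; rewrite mxE mulrA. Qed.

Lemma dotvDr u v w : dotv u (v + w) = dotv u v + dotv u w.
Proof. by rewrite dotvC dotvDl !(dotvC _ u). Qed.

Lemma dotvZr (a : R) u w : dotv u (a *: w) = a * dotv u w.
Proof. by rewrite dotvC dotvZl dotvC. Qed.

Lemma dotvNl u w : dotv (- u) w = - dotv u w.
Proof. by rewrite -scaleN1r dotvZl mulN1r. Qed.

Lemma dotvNr u w : dotv u (- w) = - dotv u w.
Proof. by rewrite dotvC dotvNl dotvC. Qed.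

Lemma dotvv_ge0 u : 0 <= dotv u u.
Proof. by apply: sumr_ge0 => j _; rewrite -expr2 sqr_ge0. Qed.

Lemma enorm_ge0 u : 0 <= enorm u. Proof. exact: sqrtr_ge0. Qed.

Lemma enorm_sqr u : enorm u ^+ 2 = dotv u u.
Proof. by rewrite sqr_sqrtr// dotvv_ge0. Qed.

Lemma enorm_le u (r : R) : 0 <= r -> (enorm u <= r) = (dotv u u <= r ^+ 2).
Proof.
by move=> r0; rewrite -enorm_sqr ler_pXn2r// nnegrE enorm_ge0.
Qed.

Lemma dotv_le u w : dotv u w <= enorm u * enorm w.
Proof.
have h (a b : R) : 0 <= dotv (a *: u - b *: w) (a *: u - b *: w) by exact: dotvv_ge0.
have {}h (a b : R) : 2 * (a * b) * dotv u w <=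
    a ^+ 2 * enorm u ^+ 2 + b ^+ 2 * enorm w ^+ 2.
  have := h a b; rewrite dotvDl !dotvDr !dotvNl !dotvNr !dotvZl !dotvZr (dotvC w u).
  by rewrite !enorm_sqr; lra.
have u0 := enorm_ge0 u; have w0 := enorm_ge0 w.
have [uE|uN] := eqVneq (enorm u) 0.
  rewrite uE mul0r leNgt; apply/negP => uw.
  have := h ((enorm w ^+ 2 + 1) / dotv u w) 1.
  have -> : 2 * ((enorm w ^+ 2 + 1) / dotv u w * 1) * dotv u w =
    2 * (enorm w ^+ 2 + 1) by field; rewrite gt_eqF.
  by rewrite uE; nra.
have [wE|wN] := eqVneq (enorm w) 0.
  rewrite wE mulr0 leNgt; apply/negP => uw.
  have := h 1 ((enorm u ^+ 2 + 1) / dotv u w).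
  have -> : 2 * (1 * ((enorm u ^+ 2 + 1) / dotv u w)) * dotv u w =
    2 * (enorm u ^+ 2 + 1) by field; rewrite gt_eqF.
  by rewrite wE; nra.
have uw0 : 0 < enorm u * enorm w by rewrite mulr_gt0// lt_def ?uN ?wN.
by have := h (enorm w) (enorm u); nra.
Qed.

Lemma enormD u w : enorm (u + w) <= enorm u + enorm w.
Proof.
rewrite enorm_le ?addr_ge0 ?enorm_ge0//.
rewrite dotvDl !dotvDr (dotvC w u) -!enorm_sqr.
by have := dotv_le u w; nra.
Qed.

Lemma enormN u : enorm (- u) = enorm u.
Proof. by rewrite /enorm dotvNl dotvNr opprK. Qed.

Lemma enormBC u w : enorm (u - w) = enorm (w - u).
Proof. by rewrite -enormN opprB. Qed.

Lemma enormZ (a : R) u : enorm (a *: u) = `|a| * enorm u.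
Proof.
by rewrite /enorm dotvZl dotvZr mulrA -expr2 sqrtrM ?sqr_ge0// sqrtr_sqr.
Qed.

Lemma coord_le_enorm u j : `|u 0 j| <= enorm u.
Proof.
rewrite -[leLHS]sqrtr_sqr; apply: ler_wsqrtr.
rewrite /dotv (bigD1 j)//= expr2 lerDl; apply: sumr_ge0 => i _.
by rewrite -expr2 sqr_ge0.
Qed.

Lemma enorm_le_coord u (r : R) : 0 <= r -> (forall j, `|u 0 j| <= r) ->
  enorm u <= k%:R * r.
Proof.
move=> r0 ur; rewrite enorm_le ?mulr_ge0//.
apply: (@le_trans _ _ (\sum_(j < k) r ^+ 2)).
  by apply: ler_sum => j _; rewrite -expr2 -real_normK ?num_real// lerXn2r ?nnegrE.
rewrite sumr_const card_ord -[leLHS]mulr_natl exprMn ler_wpM2r ?sqr_ge0//.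
by rewrite -natrX ler_nat; case: (k) => // i; rewrite expnS expn1 leq_pmulr.
Qed.

Lemma enorm_eq0 u : (enorm u == 0) = (u == 0).
Proof.
apply/eqP/eqP => [u0|->]; last first.
  by rewrite -(scale0r (0 : 'rV_k)) enormZ normr0 mul0r.
apply/rowP => j; rewrite mxE; apply/eqP; rewrite -normr_le0 -u0.
exact: coord_le_enorm.
Qed.

Lemma enorm_gt0 u : (0 < enorm u) = (u != 0).
Proof. by rewrite lt_def enorm_ge0 andbT enorm_eq0. Qed.

Lemma pythagoras V v x : x \in V ->
  dotv (v - x) (v - x) = dotv (v - orth_proj V v) (v - orth_proj V v)
    + dotv (orth_proj V v - x) (orth_proj V v - x).
Proof.
move=> xV; have [pV /memv_orthvP pO] := orth_projP V v.
have /pO o : orth_proj V v - x \in V by rewrite rpredB.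
rewrite -[in LHS](subrK (orth_proj V v) v) -(addrA (v - _)).
rewrite (dotvDl (v - _)) !(dotvDr _ (v - _)) o dotvC o; ring.
Qed.

Lemma orth_proj_min V v x : x \in V -> enorm (v - orth_proj V v) <= enorm (v - x).
Proof. by move=> /pythagoras E; apply: ler_wsqrtr; rewrite E lerDl dotvv_ge0. Qed.

Lemma enorm_orth_proj V v : enorm (orth_proj V v) <= enorm v.
Proof.
have := @pythagoras V v 0 (mem0v _); rewrite !subr0 => E.
by apply: ler_wsqrtr; rewrite E lerDr dotvv_ge0.
Qed.

(** Gram-Schmidt, recording what the lattice count uses: unit vectors of [V] and Parseval's
    identity. A unit vector is split off and the induction continues in its orthogonal complement
    inside [V]. *)
Lemma orthonormal_seq V : exists s : seq 'rV[R]_k, [/\ (size s <= \dim V)%N,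
  forall e, e \in s -> e \in V /\ enorm e = 1 &
  forall x, x \in V -> dotv x x = \sum_(e <- s) dotv x e ^+ 2].
Proof.
move: {2}(\dim V).+1 (ltnSn (\dim V)) => d.
elim: d V => // d IH V; rewrite ltnS => dV.
have [->|V0] := eqVneq V 0%VS.
  exists [::]; split=> // x; rewrite memv0 => /eqP ->.
  by rewrite big_nil /dotv big1// => j _; rewrite mxE mul0r.
have [e eV e1] : exists2 e, e \in V & enorm e = 1.
  exists ((enorm (vpick V))^-1 *: vpick V); first by rewrite memvZ// memv_pick.
  by rewrite enormZ ger0_norm ?invr_ge0 ?enorm_ge0// mulVf// enorm_eq0 vpick0.
have ee : dotv e e = 1 by rewrite -enorm_sqr e1 expr1n.
pose W := (V :&: orthv <[e]>)%VS.
have WE x : (x \in W) = (x \in V) && (dotv e x == 0).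
  rewrite memv_cap; congr (_ && _); apply/memv_orthvP/eqP => [|ex0 y].
    by apply; exact: memv_line.
  by move=> /vlineP[c ->]; rewrite dotvZl ex0 mulr0.
have dW : (\dim W < \dim V)%N.
  rewrite ltn_neqAle dimvS ?capvSl// andbT; apply/eqP => WV.
  have /eqP WVE : W == V by rewrite eqEdim capvSl WV /=.
  by move: eV; rewrite -WVE WE ee oner_eq0 andbF.
have [|s [sW sV sP]] := IH W; first exact: leq_trans dW dV.
exists (e :: s); split.
- exact: leq_ltn_trans sW dW.
- move=> x; rewrite inE => /orP[/eqP -> //|/sV[]].
  by rewrite WE => /andP[].
move=> x xV; pose y := x - dotv x e *: e.
have ey : dotv e y = 0 by rewrite dotvDr dotvNr dotvZr ee (dotvC e) mulr1 subrr.
have yW : y \in W by rewrite WE ey eqxx andbT rpredB// rpredZ.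
have yf f : f \in s -> dotv y f = dotv x f.
  move=> /sV[]; rewrite WE => /andP[_ /eqP ef] _.
  by rewrite /y dotvDl dotvNl dotvZl ef mulr0 subr0.
have xE : x = y + dotv x e *: e by rewrite subrK.
rewrite big_cons; move: (dotv x e) xE => c xE.
rewrite -(eq_big_seq _ (fun f fs => congr1 (fun r => r ^+ 2) (yf f fs))) -sP//.
rewrite xE; clearbody y.
by rewrite dotvDl !dotvDr !dotvZl !dotvZr (dotvC y e) ey ee; ring.
Qed.

End Euclid.

(** * Integer points near a subspace *)

Section GridCount.
Context {R : realType} {k : nat}.
Implicit Types (V : {vspace 'rV[R]_k}).

(** The shift by [N] keeps every grid point at length comparable to [N], so that none is near a
    subspace merely by being short. *)
Definition grid_point N (a : {ffun 'I_k -> 'I_N}) : 'rV[R]_k :=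
  \row_j (N + a j)%:R.

Definition grid_near N V (kap : R) : pred {ffun 'I_k -> 'I_N} :=
  fun a => `[< exists2 x, x \in V & enorm (grid_point a - x) <= kap >].

Lemma enorm_grid_le N (a : {ffun 'I_k -> 'I_N}) :
  enorm (grid_point a) <= (2 * k * N)%:R.
Proof.
have -> : (2 * k * N)%:R = k%:R * (2 * N)%:R :> R by rewrite -natrM; congr _%:R; lia.
apply: enorm_le_coord => // j; rewrite mxE ger0_norm// ler_nat.
by have := ltn_ord (a j); lia.
Qed.

Lemma enorm_grid_ge N (a : {ffun 'I_k -> 'I_N}) : (0 < k)%N ->
  N%:R <= enorm (grid_point a).
Proof.
move=> k0; apply: le_trans (coord_le_enorm _ (Ordinal k0)).
by rewrite mxE ger0_norm// ler_nat leq_addr.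
Qed.

Lemma truncn_dist (x y : R) : 0 <= x -> 0 <= y ->
  Num.truncn x = Num.truncn y -> `|x - y| <= 1.
Proof.
move=> x0 y0 xy; have /andP[x1 x2] := truncn_itv x0.
have /andP[] := truncn_itv y0; rewrite -xy => y1 y2.
rewrite -natr1 in x2 y2; rewrite ler_norml; lra.
Qed.

(** A near point is determined by a key: its rounded inner products with an orthonormal basis of
    [V], O(N) values for each, and its coordinates modulo a constant. Near points with equal rounded
    products differ by a vector of length at most [k%:R + 2 * kap], and then the residues force
    equality. *)
Lemma card_grid_near (kap : R) : 0 <= kap ->
  exists C : nat, forall N V, (0 < N)%N ->
    (#|grid_near (N := N) V kap| <= C * N ^ \dim V)%N.
Proof.
move=> kap0; pose K := Num.truncn (k%:R + 2 * kap).
exists ((4 * k).+1 ^ k * K.+1 ^ k)%N => N V N0.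
have [s [sV s1 sP]] := orthonormal_seq V.
(* The offset makes the inner product nonnegative, so that [truncn] acts as the floor. *)
pose c (a : {ffun 'I_k -> 'I_N}) e : R := dotv (grid_point a) e + (2 * k * N)%:R.
have c0 a e : e \in s -> 0 <= c a e <= (4 * k * N)%:R.
  move=> /s1[_ e1]; have ga := enorm_grid_le a.
  have := dotv_le (grid_point a) e; have := dotv_le (grid_point a) (- e).
  rewrite enormN e1 !mulr1 dotvNr /c => h1 h2.
  have -> : (4 * k * N)%:R = (2 * k * N)%:R + (2 * k * N)%:R :> R.
    by rewrite -natrD; congr _%:R; lia.
  by apply/andP; split; lra.
pose key (a : {ffun 'I_k -> 'I_N}) :
    {ffun 'I_(size s) -> 'I_(4 * k * N).+1} * {ffun 'I_k -> 'I_K.+1} :=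
  ([ffun i : 'I_(size s) => inord (Num.truncn (c a (tnth (in_tuple s) i)))],
   [ffun j => inord (a j %% K.+1)]).
have key_inj : {in grid_near V kap &, injective key}.
  move=> a b /asboolP[x xV ax] /asboolP[y yV bY] [k1 k2].
  have cab e : e \in s -> `|dotv (grid_point a - grid_point b) e| <= 1.
    move=> es; have /tnthP[i eE] : e \in in_tuple s by [].
    have /andP[a1 a2] := c0 a e es; have /andP[b1 b2] := c0 b e es.
    have -> : dotv (grid_point a - grid_point b) e = c a e - c b e.
      by rewrite dotvDl dotvNl /c; ring.
    apply: truncn_dist => //.
    move/ffunP: k1 => /(_ i); rewrite !ffunE -eE => /(congr1 val) /=.
    rewrite !inordK// ltnS; rewrite truncn_le_nat; apply: le_lt_trans;
      try eassumption; by rewrite ltr_nat.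
  pose z := grid_point a - grid_point b.
  have pz : enorm (orth_proj V z) <= k%:R.
    rewrite enorm_le// sP ?(orth_projP V z).1//.
    apply: (@le_trans _ _ (\sum_(e <- s) 1)).
      rewrite big_seq [leRHS]big_seq; apply: ler_sum => e es.
      have -> : dotv (orth_proj V z) e = dotv z e.
        have [_ /memv_orthvP/(_ e (s1 e es).1)] := orth_projP V z.
        by rewrite dotvC dotvDl dotvNl => /eqP; rewrite subr_eq0 => /eqP.
      by rewrite -real_normK ?num_real// exprn_ile1// cab.
    rewrite big_const_seq count_predT iter_addr_0 -natrX ler_nat.
    apply: (leq_trans sV); apply: leq_trans (dimvS (subvf V)) _.
    by rewrite dimvf /dim /= mul1n; case: (k) => // i; rewrite expnS expn1 leq_pmulr.
  have pz' : enorm (z - orth_proj V z) <= 2 * kap.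
    apply: le_trans (orth_proj_min z (rpredB xV yV)) _.
    have -> : z - (x - y) = (grid_point a - x) + - (grid_point b - y).
      by rewrite /z; apply/rowP => j; rewrite !mxE; ring.
    apply: le_trans (enormD _ _) _; rewrite enormN; lra.
  have zk : enorm z <= k%:R + 2 * kap.
    rewrite -(subrK (orth_proj V z) z) addrC.
    by apply: le_trans (enormD _ _) _; exact: lerD.
  apply/ffunP => j; apply: val_inj => /=.
  move/ffunP: k2 => /(_ j); rewrite !ffunE => /(congr1 val) /=.
  rewrite !inordK ?ltn_pmod// => abK.
  have := le_trans (coord_le_enorm z j) zk; rewrite !mxE.
  have K1 : k%:R + 2 * kap < K.+1%:R by apply: truncnS_gt.
  have dist (p q : nat) : `|(N + p)%:R - (N + q)%:R : R| < K.+1%:R ->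
      p = q %[mod K.+1] -> (q <= p)%N -> p = q.
    move=> pq pqK qp; move: pq; rewrite -natrB ?leq_add2l// subnDl normr_nat ltr_nat.
    move/eqP: pqK; rewrite eqn_mod_dvd// => /dvdnP[i iE].
    rewrite iE -{2}[K.+1]mul1n ltn_pmul2r// ltnS leqn0 => /eqP i0.
    by move: iE; rewrite i0 mul0n; lia.
  move=> /le_lt_trans/(_ K1) abN.
  have [ba|/ltnW ab] := leqP (b j) (a j); first exact: (dist (a j) (b j) abN).
  by apply/esym/dist => //; rewrite distrC.
rewrite -(card_in_imset key_inj); apply: leq_trans (max_card _) _.
rewrite card_prod !card_ffun !card_ord [leqRHS]mulnAC; apply: leq_mul => //.
have sk : (\dim V <= k)%N.
  by apply: leq_trans (dimvS (subvf V)) _; rewrite dimvf /dim /= mul1n.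
apply: (@leq_trans (((4 * k).+1 * N) ^ \dim V)).
  apply: (@leq_trans ((4 * k * N).+1 ^ \dim V)); first by rewrite leq_pexp2l.
  by case: (\dim V) => // d; rewrite leq_exp2r//; nia.
by rewrite expnMn leq_mul2r leq_pexp2l// orbT.
Qed.

End GridCount.

(** * Transitivity of the unitary group on spheres *)

Section UnitaryTransitive.
Context {R : realType} {n : nat}.
Implicit Types z w : 'rV[R]_(n + n).

Lemma dotv_split z w : dotv z w =
  \sum_(j < n) (lsubmx z 0 j * lsubmx w 0 j + rsubmx z 0 j * rsubmx w 0 j).
Proof.
rewrite /dotv big_split_ord /= -big_split; apply: eq_bigr => j _.
by rewrite !mxE.
Qed.

Lemma toC_norm z : (toC z *m (toC z)^t*%sesqui) 0 0 = ((dotv z z)%:C)%C.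
Proof.
rewrite mxE dotv_split (rmorph_sum (@complex.real_complex R)).
apply: eq_bigr => j _; rewrite !mxE; apply/eqP; rewrite eq_complex /=.
by apply/andP; split; apply/eqP; ring.
Qed.

Lemma toCB z w : toC (z - w) = toC z - toC w.
Proof. by rewrite addrC -scaleN1r toC_linear rmorphN1 scaleN1r addrC. Qed.

(* The reflection-like map [x |-> x - <x, u> / <a, u> u] with u = a - b sends a
   to b; it is unitary because [2 Re <a, u> = |u|^2] when [|a| = |b|]. *)
Lemma unitary_transitive z w : enorm z = enorm w ->
  exists U : unitaryG R n, unitary_map U z = w.
Proof.
move=> zw; have [<-|zNw] := eqVneq z w.
  have U1 : (1%:M : 'M[R[i]]_n) \is unitarymx by apply/unitarymxP; rewrite trmx1 map_mx1 mulmx1.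
  by exists (exist _ 1%:M U1); rewrite /unitary_map /= mulmx1 toCK.
pose a := toC z; pose b := toC w; pose u := a - b.
pose ip (x y : 'rV[R[i]]_n) := (x *m y^t*%sesqui) 0 0.
have ipE x y : x *m y^t*%sesqui = (ip x y)%:M by rewrite [LHS]mx11_scalar.
have ipC x y : ip y x = (ip x y)^*%R.
  rewrite /ip !mxE rmorph_sum; apply: eq_bigr => j _.
  by rewrite !mxE rmorphM /= conjCK mulrC.
pose al := ip a u.
have ipBr x y y' : ip x (y - y') = ip x y - ip x y'.
  by rewrite /ip linearB /= map_mxB mulmxBr !mxE.
have ipBl x x' y : ip (x - x') y = ip x y - ip x' y.
  by rewrite /ip mulmxBl !mxE.
have nu : ip u u = al + al^*%R.
  rewrite /al /u ipBr !ipBl !ipBr rmorphB /= -!ipC.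
  have -> : ip b b = ip a a by rewrite /ip !toC_norm -!enorm_sqr zw.
  ring.
have nu0 : ip u u != 0.
  rewrite /ip /u /a /b -toCB toC_norm -enorm_sqr.
  rewrite -[0]/((0 : R)%:C)%C (inj_eq (@complexI R)) expf_eq0 /= enorm_eq0.
  by rewrite subr_eq0.
have al0 : al != 0 by apply: contra nu0; rewrite nu => /eqP ->; rewrite rmorph0 addr0.
pose P := u^t*%sesqui *m u.
pose M := 1%:M - al^-1 *: P.
have PP : P *m P = ip u u *: P.
  by rewrite /P mulmxA -[_ *m u *m _]mulmxA ipE mul_mx_scalar -scalemxAl.
have Pt : P^t*%sesqui = P.
  rewrite /P trmx_mul map_mxM /=; congr (_ *m _).
  by apply/matrixP => i j; rewrite !mxE conjCK.
have MU : M \is unitarymx.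
  have Mt : M^t*%sesqui = 1%:M - (al^-1)^*%R *: P.
    rewrite -[in RHS]Pt; apply/matrixP => i j; rewrite !mxE rmorphB rmorphM /=.
    by rewrite rmorph_nat eq_sym.
  apply/unitarymxP; rewrite Mt /M.
  rewrite mulmxBl !mulmxBr !mul1mx !mulmx1 -scalemxAl -scalemxAr PP !scalerA.
  set c := (_ * _ * _); rewrite /=.
  have -> : c = al^-1 + (al^-1)^*%R.
    rewrite /c nu fmorphV; field; rewrite al0 /=.
    by rewrite conjC_eq0 al0.
  by rewrite scalerDl; apply/matrixP => i j; rewrite !mxE; ring.
exists (exist _ M MU); rewrite /unitary_map /= -[RHS]toCK; congr ofC.
rewrite /M mulmxBr mulmx1 -scalemxAr mulmxA ipE mul_scalar_mx scalerA mulVf// scale1r.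
by rewrite /u opprB addrC subrK.
Qed.

End UnitaryTransitive.

(** * Measure of the planes close to a vector *)

Section FiniteSums.
Context {R : realType} {d : measure_display} {T : measurableType d}.
Variable mu : probability T R.

Definition pr (S : set T) : R := fine (mu S).

Lemma prE S : measurable S -> mu S = (pr S)%:E.
Proof. by move=> mS; rewrite /pr fineK// fin_num_measure. Qed.

Lemma pr_le1 S : measurable S -> pr S <= 1.
Proof. by move=> mS; rewrite -lee_fin -prE// probability_le1. Qed.

Lemma pr_mono S S' : measurable S -> measurable S' -> S `<=` S' -> pr S <= pr S'.
Proof.
by move=> mS mS' SS; rewrite -lee_fin -!prE// le_measure ?inE.
Qed.

Definition simple_sum {I : Type} (l : seq I) (c : I -> R) (S : I -> set T) (x : T) : R :=
  \sum_(i <- l) c i * \1_(S i) x.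

Section One.
Context {I : Type} (l : seq I) (c : I -> R) (S : I -> set T).
Hypotheses (c0 : forall i, 0 <= c i) (mS : forall i, measurable (S i)).

Lemma simple_sum_ge0 x : 0 <= simple_sum l c S x.
Proof. by apply: sumr_ge0 => i _; rewrite mulr_ge0. Qed.

Lemma measurable_simple_sum : measurable_fun setT (fun x => (simple_sum l c S x)%:E).
Proof.
apply/measurable_EFinP; apply: measurable_sum => i.
by apply: measurable_funM => //; exact: measurable_indic.
Qed.

Lemma integral_simple_sum :
  (\int[mu]_x (simple_sum l c S x)%:E = (\sum_(i <- l) c i * pr (S i))%:E)%E.
Proof.
rewrite (eq_integral (fun x => (\sum_(i <- l) (c i * \1_(S i) x)%:E)%E)); last first.
  by move=> x _; rewrite sumEFin.
rewrite ge0_integral_sum//; last 2 first.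
- move=> i; apply/measurable_EFinP.
  by apply: measurable_funM => //; exact: measurable_indic.
- by move=> i x _; rewrite lee_fin mulr_ge0.
rewrite -sumEFin; apply: eq_bigr => i _.
under eq_integral do rewrite EFinM.
rewrite ge0_integralZl_EFin//; last first.
  by apply/measurable_EFinP; exact: measurable_indic.
by rewrite integral_indic// setIT EFinM -prE.
Qed.

End One.

Lemma sum_pr_le {I : Type} (l : seq I) (c : I -> R) (S : I -> set T) M :
  (forall i, 0 <= c i) -> (forall i, measurable (S i)) ->
  (forall x, simple_sum l c S x <= M) -> \sum_(i <- l) c i * pr (S i) <= M.
Proof.
move=> c0 mS cM; rewrite -lee_fin -integral_simple_sum//.
apply: (@le_trans _ _ (\int[mu]_(x in setT) (cst M%:E x)))%E.
  apply: ge0_le_integral => //.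
  - by move=> x _; rewrite lee_fin simple_sum_ge0.
  - exact: measurable_simple_sum.
  - by move=> x _; rewrite lee_fin.
by rewrite integral_cst// [X in (_ * X)%E](@probability_setT _ _ _ mu) mule1.
Qed.

(** By Fatou's lemma the lower limit of the sums is integrable, hence finite almost everywhere; at
    such a point infinitely many sums lie below the lower limit plus 1. *)
Lemma fatou_simple_sum {I : Type} (l : nat -> seq I) (c : nat -> I -> R)
    (S : nat -> I -> set T) M :
  (forall k i, 0 <= c k i) -> (forall k i, measurable (S k i)) ->
  (forall k, \sum_(i <- l k) c k i * pr (S k i) <= M) ->
  {ae mu, forall x, exists B, forall k0, exists2 k, (k0 <= k)%N &
    simple_sum (l k) (c k) (S k) x <= B}.
Proof.
move=> c0 mS cM.
pose f k x := (simple_sum (l k) (c k) (S k) x)%:E.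
have f0 k x : (0 <= f k x)%E by rewrite lee_fin simple_sum_ge0.
have mf k : measurable_fun setT (f k) by exact: measurable_simple_sum.
have einf_le (u : (\bar R)^nat) (e : \bar R) : (forall k, u k <= e)%E -> (limn_einf u <= e)%E.
  move=> ue; rewrite limn_einf_lim; apply: lime_le; first exact: is_cvg_einfs.
  apply: nearW => k; apply: le_trans (ue k); apply: ereal_inf_lbound.
  by exists k => /=.
have einf_ge (u : (\bar R)^nat) (e : \bar R) k0 :
    (forall k, (k0 <= k)%N -> e <= u k)%E -> (e <= limn_einf u)%E.
  move=> ue; rewrite limn_einf_lim; apply: lime_ge; first exact: is_cvg_einfs.
  exists k0 => // k /= kk0; apply: le_ereal_inf_tmp => _ [j /= kj <-].
  by apply: ue; exact: leq_trans kj.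
have fi : mu.-integrable setT (fun x => limn_einf (f^~ x)).
  apply/integrableP; split.
    apply: (measurableT_comp (f := -%E)) => //.
    by apply: measurable_fun_limn_esup => k; exact: (measurableT_comp (f := -%E)).
  rewrite (eq_integral (fun x => limn_einf (f^~ x))); last first.
    by move=> x _; rewrite gee0_abs//; apply: (einf_ge _ _ 0%N).
  apply: le_lt_trans (fatou _ _ _ _) _ => //.
  apply: (@le_lt_trans _ _ M%:E); last by rewrite ltry.
  by apply: einf_le => k; rewrite integral_simple_sum// lee_fin.
have := integrable_ae measurableT fi; apply: filterS => x /(_ Logic.I) xfin.
exists (fine (limn_einf (f^~ x)) + 1) => k0; apply: contrapT => nk.
have : ((fine (limn_einf (f^~ x)) + 1)%:E <= limn_einf (f^~ x))%E.
  apply: (einf_ge _ _ k0) => k kk; rewrite lee_fin leNgt; apply/negP => kf.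
  by apply: nk; exists k => //; exact: ltW.
by rewrite -[leRHS]fineK// lee_fin gerDl ler10.
Qed.

End FiniteSums.

Section NearMeasure.
Context {R : realType} {n m : nat} {hmn : (m <= n)%N}.
Hypothesis hm : (1 <= m)%N.
Implicit Types (v w : 'rV[R]_(n + n)) (r : R).

(** Stated with an arbitrary point of the plane instead of the projection, so that dilations and
    unitary maps can be applied without computing projections. *)
Definition close_planes v r : set (borelType (isoGrass R hmn)) :=
  [set V : borelType (isoGrass R hmn) | exists2 x, x \in val V & enorm (v - x) <= r].

Lemma close_planesE v r : close_planes v r =
  [set V : borelType (isoGrass R hmn) | enorm (v - orth_proj (val V) v) <= r].
Proof.
apply/seteqP; split=> V /=.
  by move=> [x xV]; apply: le_trans; exact: orth_proj_min.
by exists (orth_proj (val V) v) => //; exact: (orth_projP _ _).1.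
Qed.

Lemma mulmx_proj_mx_of v (V : isoGrass R hmn) :
  v *m proj_mx_of V = orth_proj (val V) v.
Proof. exact: mul_rV_lin1. Qed.

(** For r >= 0 this set is closed in the topology induced by the projection matrices: it is the
    preimage of a sublevel set of a polynomial in the matrix entries. For r < 0 it is empty, and
    squaring the inequality would be wrong. *)
Lemma measurable_close_planes v r : measurable (close_planes v r).
Proof.
have [r0|r0] := ltP r 0.
  rewrite (_ : close_planes v r = set0); first exact: measurable0.
  apply/seteqP; split=> // V [x _ vx].
  by have := le_lt_trans vx r0; rewrite ltNge enorm_ge0.
pose g (M : 'M[R]_(n + n)) := dotv (v - v *m M) (v - v *m M).
have gc : continuous g.
  have cj j : continuous (fun M : 'M[R]_(n + n) => (v - v *m M) 0 j).
    rewrite (_ : (fun _ => _) = fun M : 'M[R]_(n + n) => v 0 j - \sum_(i < n + n) v 0 i * M i j); last first.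
      by apply/funext => M; rewrite !mxE.
    move=> M; apply: (@continuousB _ R^o); first exact: cst_continuous.
    apply: continuous_big => [|i _]; first exact: add_continuous.
    by move=> {}M; apply: continuousM; [exact: cst_continuous|exact: coord_continuous].
  apply: continuous_big => [|j _]; first exact: add_continuous.
  by move=> M; apply: continuousM; exact: cj.
have cl : closed [set M | g M <= r ^+ 2].
  by apply: (@preimage_closed _ _ _ [set x | x <= r ^+ 2]) => //; exact: closed_le.
rewrite -[close_planes v r]setCK; apply: measurableC.
apply: sub_sigma_algebra; exists (~` [set M | g M <= r ^+ 2]); first exact: closed_openC.
rewrite close_planesE; apply/seteqP; split=> V /=;
by rewrite /g mulmx_proj_mx_of enorm_le.
Qed.

Lemma close_planes_unitary (U : unitaryG R n) v r :
  (unitary_act U : borelType (isoGrass R hmn) -> borelType (isoGrass R hmn))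
    @^-1` close_planes (unitary_map U v) r = close_planes v r.
Proof.
have nU x : enorm (unitary_map U x) = enorm x.
  rewrite /enorm; congr Num.sqrt; apply: (@complexI R).
  rewrite -!toC_norm ofCK trmx_mul map_mxM mulmxA -[_ *m val U *m _]mulmxA.
  by rewrite (unitarymxP (valP U)) mulmx1.
apply/seteqP; split=> V [x].
  move=> /memv_imgP[y yV ->]; rewrite lfunE /= -linearB nU => vy.
  by exists y.
move=> xV vx; exists (unitary_map U x); last by rewrite -linearB nU.
by rewrite /=; have := memv_img (linfun (unitary_map U)) xV; rewrite lfunE.
Qed.

Lemma close_planesZ (c : R) v r : 0 < c ->
  close_planes (c *: v) (c * r) = close_planes v r.
Proof.
move=> c0; apply/seteqP; split=> V [x xV vx].
  exists (c^-1 *: x); first exact: memvZ.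
  have -> : v - c^-1 *: x = c^-1 *: (c *: v - x).
    by rewrite scalerBr scalerA mulVf ?scale1r// gt_eqF.
  by rewrite enormZ gtr0_norm ?invr_gt0// ler_pdivrMl.
exists (c *: x); first exact: memvZ.
by rewrite -scalerBr enormZ gtr0_norm// ler_pM2l.
Qed.

Lemma close_planes_mono v r r' : r <= r' -> close_planes v r `<=` close_planes v r'.
Proof. by move=> rr V [x xV vx]; exists x => //; exact: le_trans rr. Qed.

Variables (mu : probability (borelType (isoGrass R hmn)) R).
Hypothesis hmu : unitary_invariant mu.

Lemma pr_close_planes_eq v w r : enorm v = enorm w ->
  pr mu (close_planes v r) = pr mu (close_planes w r).
Proof.
move=> /unitary_transitive[U <-].
rewrite /pr -(hmu U (measurable_close_planes (unitary_map U v) r)).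
by rewrite close_planes_unitary.
Qed.

(* Double counting over the grid points of [N, 2N)^2n: by invariance they are all
   equally likely to be close to a plane, up to scaling. *)
Lemma pr_close_planes_le : exists2 C : R, 0 < C & forall v r, v != 0 -> 0 < r ->
  pr mu (close_planes v r) <= C * (r / enorm v) ^+ (n + n - m).
Proof.
have n0 : (0 < n + n)%N by rewrite addn_gt0 (leq_trans hm hmn).
(* Scaling [v] to a grid point multiplies [r] by at most 2 (2n) N / |v|, and N <= |v| / r, so the
   scaled radius never exceeds [kap]. *)
pose kap : R := (2 * (n + n))%:R.
have [C0 C0P] := @card_grid_near R (n + n) kap (ler0n _ _).
exists ((C0%:R + 1) * 2 ^+ (n + n - m)); first by rewrite mulr_gt0// ?exprn_gt0// ltr_wpDl.
move=> v r v0 r0; have vn : 0 < enorm v by rewrite enorm_gt0.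
rewrite -mulrA -exprMn.
have C1 : 1 <= C0%:R + 1 :> R by rewrite lerDr.
(* For |v| < 2 r the asserted bound is at least 1. *)
have [rv|rv] := ltP (enorm v) (2 * r).
  apply: le_trans (pr_le1 mu (measurable_close_planes v r)) _.
  rewrite -[leLHS]mulr1; apply: ler_pM => //; apply: exprn_ege1.
  by rewrite mulrA ler_pdivlMr// mul1r ltW.
pose N := Num.truncn (enorm v / r).
have vr0 : 0 <= enorm v / r by rewrite divr_ge0// ltW.
have /andP[Nv vN] := truncn_itv vr0; rewrite -/N in Nv vN.
have N0 : (0 < N)%N.
  by rewrite truncn_gt0 ler_pdivlMr//; lra.
have N2 : enorm v / r <= 2 * N%:R.
  by apply: ltW; apply: lt_le_trans vN _; rewrite -natrM ler_nat; lia.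
have Ngt0 : 0 < N%:R :> R by rewrite ltr0n.
have step (a : {ffun 'I_(n + n) -> 'I_N}) :
    pr mu (close_planes v r) <= pr mu (close_planes (grid_point a) kap).
  have g0 := enorm_grid_ge (R := R) a n0.
  have gp : 0 < enorm (grid_point a : 'rV[R]_(n + n)) by apply: lt_le_trans g0.
  pose c := enorm (grid_point a : 'rV[R]_(n + n)) / enorm v.
  have c0 : 0 < c by rewrite divr_gt0.
  rewrite -(close_planesZ v r c0) (pr_close_planes_eq _ (w := grid_point a)); last first.
    by rewrite enormZ gtr0_norm// /c divfK ?gt_eqF.
  apply: pr_mono; [exact: measurable_close_planes..|].
  apply: close_planes_mono; rewrite /c mulrAC ler_pdivrMr//.
  have ga := enorm_grid_le (R := R) a.
  rewrite ler_pdivlMr// in Nv; apply: le_trans (ler_wpM2r (ltW r0) ga) _.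
  rewrite natrM -mulrA; apply: ler_wpM2l => //.
have := @sum_pr_le _ _ _ mu _ (enum {ffun 'I_(n + n) -> 'I_N}) (fun=> 1)
  (fun a => close_planes (grid_point a) kap) (C0 * N ^ m)%:R
  (fun=> ler01) (fun a => measurable_close_planes _ _).
have cnt V : simple_sum (enum {ffun 'I_(n + n) -> 'I_N}) (fun=> 1 : R)
    (fun a => close_planes (grid_point a) kap) V <= (C0 * N ^ m)%:R.
  have /andP[_ /eqP dV] := valP V.
  rewrite (_ : simple_sum _ _ _ _ = #|grid_near (N := N) (val V) kap|%:R).
    by rewrite ler_nat; have := C0P N (val V) N0; rewrite dV.
  rewrite /simple_sum big_enum /= -sum1_card natr_sum [RHS]big_mkcond /=.
  apply: eq_bigr => a _; rewrite mul1r indicE unfold_in /grid_near /=.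
  case: asboolP => h; first by rewrite mem_set.
  by rewrite memNset.
move=> /(_ cnt); rewrite big_enum /= => sumle.
have : N%:R ^+ (n + n) * pr mu (close_planes v r) <= C0%:R * N%:R ^+ m.
  rewrite -!natrX -[leRHS]natrM; apply: le_trans sumle.
  rewrite -[X in X%:R](_ : #|{ffun 'I_(n + n) -> 'I_N}| = _); last first.
    by rewrite card_ffun !card_ord.
  rewrite mulr_natl -sumr_const; apply: ler_sum => a _.
  by rewrite mul1r; exact: step.
have mnn : (m <= n + n)%N by rewrite (leq_trans hmn)// leq_addr.
rewrite -{1}(subnK mnn) exprD -mulrA mulrCA mulrC ler_pM2r ?exprn_gt0// => h.
have {h} : pr mu (close_planes v r) <= C0%:R / N%:R ^+ (n + n - m).
  by rewrite ler_pdivlMr ?exprn_gt0// mulrC.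
move=> /le_trans; apply; apply: ler_pM => //.
  by rewrite lerDl.
rewrite -exprVn; apply: lerXn2r; rewrite ?nnegrE ?invr_ge0//.
  by rewrite mulr_ge0// divr_ge0// ltW.
rewrite -[leLHS]mul1r ler_pdivrMr//.
have -> : 2 * (r / enorm v) * N%:R = 2 * N%:R * r / enorm v by ring.
by rewrite ler_pdivlMr// mul1r -ler_pdivrMr.
Qed.

End NearMeasure.

(** * Dyadic cubes *)

Section DyadicCode.
Context {R : realType} {X : eqType} (d : nat) (y : nat -> X -> R) (B : set X).
Hypotheses (d0 : (0 < d)%N)
  (yB : forall x i, B x -> (i < d)%N -> 0 <= y i x < 1).

Definition dyadic k i x := Num.truncn (2 ^+ k * y i x).

(* The binary digits of the d coordinates, interleaved. *)
Definition digits x j : bool := odd (dyadic (j %/ d).+1 (j %% d) x).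

Let y2_ge0 k i x : B x -> (i < d)%N -> 0 <= 2 ^+ k * y i x.
Proof. by move=> Bx id; rewrite mulr_ge0 ?exprn_ge0//; case/andP: (yB Bx id). Qed.

Lemma dyadic_half k i x : B x -> (i < d)%N -> dyadic k i x = (dyadic k.+1 i x)./2.
Proof.
move=> Bx id; apply: truncn_def.
have /andP[] := truncn_itv (y2_ge0 k.+1 Bx id); rewrite -/(dyadic k.+1 i x).
move: (dyadic _ _ _) => t; rewrite exprS -mulrA.
have h1 : (t./2 * 2 <= t)%N by lia.
have h2 : (t.+1 <= t./2.+1 * 2)%N by lia.
rewrite -!(ler_nat R) !natrM in h1 h2; move=> h3 h4.
by apply/andP; split; lra.
Qed.

Lemma dyadic0 i x : B x -> (i < d)%N -> dyadic 0 i x = 0%N.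
Proof.
move=> Bx id; apply: truncn_def; rewrite expr0 mul1r.
exact: yB.
Qed.

Lemma same_cell_dyadic k x x' : B x -> B x' ->
  mkseq (digits x) (d * k) = mkseq (digits x') (d * k) ->
  forall i, (i < d)%N -> dyadic k i x = dyadic k i x'.
Proof.
move=> Bx Bx'; elim: k => [|k IH] E i id; first by rewrite !dyadic0.
have {}IH : dyadic k i x = dyadic k i x'.
  apply: IH => //; move/(congr1 (take (d * k))): E.
  by rewrite /mkseq -!map_take !take_iota mulnS (minn_idPl (leq_addl _ _)).
have jk : (d * k + i < d * k.+1)%N by rewrite mulnS addnC ltn_add2r.
have := congr1 (fun s => nth false s (d * k + i)) E.
rewrite !nth_mkseq// /digits [(d * k)%N]mulnC divnMDl// divn_small// addn0.
rewrite modnMDl modn_small// => oE.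
by rewrite -[LHS]odd_double_half -[RHS]odd_double_half oE -!dyadic_half// IH.
Qed.

Lemma dyadic_same_cell k x x' : B x -> B x' ->
  (forall i, (i < d)%N -> dyadic k i x = dyadic k i x') ->
  mkseq (digits x) (d * k) = mkseq (digits x') (d * k).
Proof.
move=> Bx Bx' E; apply/eq_in_map => j; rewrite mem_iota add0n /= => jk.
have md : (j %% d < d)%N by rewrite ltn_mod.
have jd : (j %/ d < k)%N by rewrite ltn_divLR// mulnC.
suff h l : (l <= k)%N -> dyadic l (j %% d) x = dyadic l (j %% d) x'.
  by rewrite /digits h.
move=> lk; rewrite -(subKn lk); elim: (k - l)%N (leq_subr l k) => [|i IH] ik.
  by rewrite subn0 E.
have ki : (k - i = (k - i.+1).+1)%N by lia.
by rewrite dyadic_half// -ki IH ?(ltnW ik)// ki -dyadic_half.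
Qed.

Lemma same_cell_close k x x' : B x -> B x' ->
  mkseq (digits x) (d * k) = mkseq (digits x') (d * k) ->
  forall i, (i < d)%N -> `|y i x - y i x'| <= 2^-1 ^+ k.
Proof.
move=> Bx Bx' E i id; have := same_cell_dyadic Bx Bx' E id.
move=> /(truncn_dist (y2_ge0 k Bx id) (y2_ge0 k Bx' id)).
by rewrite -mulrBr normrM ger0_norm ?exprn_ge0// exprVn -ler_pdivlMl ?exprn_gt0// mulr1.
Qed.

Definition coord_close k x x' : bool :=
  [forall i : 'I_d, `|y i x - y i x'| <= 2^-1 ^+ k].

Lemma coord_close_dyadic k x x' i : B x -> B x' -> coord_close k x x' -> (i < d)%N ->
  (dyadic k i x' <= (dyadic k i x).+1)%N.
Proof.
move=> Bx Bx' /forallP h id; have /= := h (Ordinal id).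
rewrite exprVn -[leRHS]mul1r ler_pdivlMr ?exprn_gt0// -[X in _ * X]ger0_norm ?exprn_ge0//.
rewrite -normrM mulrBl ler_norml => /andP[h1 _].
rewrite -ltnS /dyadic truncn_lt_nat ?y2_ge0//.
have /andP[_] := truncn_itv (y2_ge0 k Bx id).
move: (Num.truncn _) => t ht; rewrite -[t.+2%:R]natr1; lra.
Qed.

(* Points of a dyadic cube and its neighbours with equal index vectors modulo 3
   lie in the same cube. *)
Lemma ball_mass (L : seq (R * X)) k p (e : R) : B p -> 0 <= e ->
  (forall q, q \in L -> 0 <= q.1 /\ B q.2) ->
  (forall v, size v = (d * k)%N -> mass L (cell digits v) <= e) ->
  \sum_(q <- L | coord_close k p q.2) q.1 <= (3 ^ d)%:R * e.
Proof.
move=> Bp e0 LB Le.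
pose cl (q : R * X) : {ffun 'I_d -> 'I_3} := [ffun i : 'I_d => inord (dyadic k i q.2 %% 3)].
rewrite (partition_big cl xpredT)//=.
have -> : (3 ^ d)%:R * e = \sum_(f : {ffun 'I_d -> 'I_3}) e.
  by rewrite sumr_const card_ffun !card_ord mulr_natl.
apply: ler_sum => f _.
have [/hasP[q0 q0L /andP[pq0 /eqP cq0]]|/hasPn none] :=
  boolP (has (fun q => coord_close k p q.2 && (cl q == f)) L); last first.
  by rewrite big_seq_cond big1// => q /andP[/none/negbTE ->].
apply: le_trans (Le (mkseq (digits q0.2) (d * k)) (size_mkseq _ _)).
rewrite /mass [leLHS]big_mkcond [leRHS]big_mkcond /= big_seq [leRHS]big_seq.
apply: ler_sum => q qL; have [q1 Bq] := LB q qL; have [_ Bq0] := LB q0 q0L.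
case: ifP => [/andP[pq /eqP cq]|_]; last by case: ifP.
rewrite ifT//; apply/asboolP; rewrite /cell /= size_mkseq.
apply: dyadic_same_cell => // i id.
have cs x x' : coord_close k x x' = coord_close k x' x.
  by apply: eq_forallb => j; rewrite distrC.
have := coord_close_dyadic Bp Bq pq id; have := coord_close_dyadic Bp Bq0 pq0 id.
rewrite cs in pq; rewrite cs in pq0.
have := coord_close_dyadic Bq Bp pq id; have := coord_close_dyadic Bq0 Bp pq0 id.
have := cq0; rewrite -cq => /ffunP/(_ (Ordinal id)); rewrite !ffunE.
move=> /(congr1 val) /=; rewrite !inordK ?ltn_pmod//; lia.
Qed.

End DyadicCode.

(** * Energies *)

Section EnergyBound.
Context {R : realType} {X : eqType}.

Lemma geometric_le (x : R) k : 0 <= x < 1 -> \sum_(0 <= i < k) x ^+ i <= (1 - x)^-1.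
Proof.
move=> /andP[x0 x1]; rewrite -[leRHS]mul1r ler_pdivlMr ?subr_gt0//.
have -> : (\sum_(0 <= i < k) x ^+ i) * (1 - x) = 1 - x ^+ k.
  elim: k => [|k IH]; first by rewrite big_geq// mul0r expr0 subrr.
  by rewrite big_nat_recr//= mulrDl IH exprS; ring.
by rewrite gerBl exprn_ge0.
Qed.

Variables (F : nat -> X -> X -> R) (cl : nat -> X -> X -> bool) (B : set X).
Variables (C0 K sig th tau : R).
Hypotheses (C00 : 0 <= C0) (K0 : 0 <= K) (th0 : 0 <= th) (th_sig : th < sig).
Hypotheses (tau0 : 0 <= tau) (ts : tau * sig < 1).
Hypothesis FP : forall j p q, B p -> B q ->
  F j p q <= C0 * \sum_(0 <= i < j.+1) th ^+ (j - i) * (cl i p q)%:R.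

(** With tau = 2^t, the sum of tau^j over the scales 2^-j >= |p - q| is comparable to |p - q|^-t, so
    the left side discretizes a t-energy. The kernel decays like th^(j - i) past a scale i at which
    p and q are close, and balls at scale i have mass at most [K * sig ^+ i]; summing over i and
    then over j gives geometric series of ratios [th / sig] and [tau * sig]. *)
Lemma energy_bound (L : seq (R * X)) k :
  (forall p, p \in L -> 0 <= p.1 /\ B p.2) ->
  (forall i p, (i <= k)%N -> p \in L ->
    \sum_(q <- L | cl i p.2 q.2) q.1 <= K * sig ^+ i) ->
  \sum_(0 <= j < k.+1) tau ^+ j *
    (\sum_(p <- L) p.1 * \sum_(q <- L) q.1 * F j p.2 q.2) <=
  (\sum_(p <- L) p.1) * (C0 * K * (1 - th / sig)^-1 * (1 - tau * sig)^-1).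
Proof.
move=> LB Lcl; have sig0 : 0 < sig := le_lt_trans th0 th_sig.
have L0 : 0 <= \sum_(p <- L) p.1 by rewrite big_seq sumr_ge0// => p /LB[].
have ths : 0 <= th / sig < 1 by rewrite divr_ge0 ?(ltW sig0)//= ltr_pdivrMr// mul1r.
have tss : 0 <= tau * sig < 1 by rewrite mulr_ge0 ?(ltW sig0).
have in1 j p : (j <= k)%N -> p \in L ->
    \sum_(q <- L) q.1 * F j p.2 q.2 <= C0 * K * (1 - th / sig)^-1 * sig ^+ j.
  move=> jk pL; have [_ Bp] := LB p pL.
  apply: (@le_trans _ _ (\sum_(q <- L) q.1 *
      (C0 * \sum_(0 <= i < j.+1) th ^+ (j - i) * (cl i p.2 q.2)%:R))).
    rewrite big_seq [leRHS]big_seq; apply: ler_sum => q qL; have [q0 Bq] := LB q qL.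
    by apply: ler_wpM2l => //; exact: FP.
  have -> : \sum_(q <- L) q.1 *
      (C0 * \sum_(0 <= i < j.+1) th ^+ (j - i) * (cl i p.2 q.2)%:R) =
      C0 * \sum_(0 <= i < j.+1) th ^+ (j - i) * \sum_(q <- L | cl i p.2 q.2) q.1.
    rewrite mulr_sumr; under eq_bigr do rewrite mulrCA mulr_sumr mulr_sumr.
    rewrite exchange_big /=; apply: eq_bigr => i _.
    rewrite [in RHS]big_mkcond !mulr_sumr; apply: eq_bigr => q _.
    by case: (cl _ _ _); rewrite ?mulr1 ?mulr0 //; ring.
  apply: (@le_trans _ _ (C0 * \sum_(0 <= i < j.+1) th ^+ (j - i) * (K * sig ^+ i))).
    apply: ler_wpM2l => //; rewrite big_nat_cond [leRHS]big_nat_cond.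
    apply: ler_sum => i /andP[/andP[_ ij] _].
    apply: ler_wpM2l; first exact: exprn_ge0.
    by apply: Lcl => //; rewrite ltnS in ij; exact: leq_trans ij jk.
  have -> : \sum_(0 <= i < j.+1) th ^+ (j - i) * (K * sig ^+ i) =
      K * sig ^+ j * \sum_(0 <= i < j.+1) (th / sig) ^+ i.
    rewrite big_nat_rev mulr_sumr /=; apply: eq_big_nat => i /andP[_ ij].
    rewrite add0n subSS; have ij' : (i <= j)%N by rewrite -ltnS.
    rewrite subKn// expr_div_n -[in RHS](subnK ij') exprD.
    by field; rewrite expf_neq0// gt_eqF.
  rewrite -!mulrA; do 2 apply: ler_wpM2l => //.
  rewrite [leRHS]mulrC; apply: ler_wpM2l; first by rewrite exprn_ge0// ltW.
  exact: geometric_le.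
set c := C0 * K * (1 - th / sig)^-1 in in1 *.
have c0 : 0 <= c.
  by case/andP: ths => *; rewrite !mulr_ge0// invr_ge0 subr_ge0 ltW.
apply: (@le_trans _ _ (\sum_(0 <= j < k.+1) tau ^+ j * (\sum_(p <- L) p.1 * (c * sig ^+ j)))).
  rewrite big_nat_cond [leRHS]big_nat_cond; apply: ler_sum => j /andP[/andP[_ jk] _].
  apply: ler_wpM2l; first exact: exprn_ge0.
  rewrite big_seq [leRHS]big_seq; apply: ler_sum => p pL; have [p0 _] := LB p pL.
  by apply: ler_wpM2l => //; exact: in1.
have -> : \sum_(0 <= j < k.+1) tau ^+ j * (\sum_(p <- L) p.1 * (c * sig ^+ j)) =
    (\sum_(p <- L) p.1) * (c * \sum_(0 <= j < k.+1) (tau * sig) ^+ j).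
  rewrite !mulr_sumr; apply: eq_bigr => j _; rewrite -mulr_suml exprMn; ring.
apply: ler_wpM2l => //; apply: ler_wpM2l => //.
exact: geometric_le.
Qed.

End EnergyBound.

Section EnergySum.
Context {R : realType} {X : eqType} {T : Type}.
Variables (tau : R) (S : nat -> X -> X -> set T).

(** The sum over scales and pairs is flattened into one list, the shape to which [fatou_simple_sum]
    applies. *)
Definition energy_index (L : seq (R * X)) k :=
  [seq (j, pq) | j <- iota 0 k.+1, pq <- [seq (p, q) | p <- L, q <- L]].

(** The absolute values make the coefficient nonnegative at every index, not only at those coming
    from a list of nonnegative masses. *)
Definition energy_coef (i : nat * ((R * X) * (R * X))) : R :=
  tau ^+ i.1 * (`|i.2.1.1| * `|i.2.2.1|).

Definition energy_set (i : nat * ((R * X) * (R * X))) := S i.1 i.2.1.2 i.2.2.2.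

Lemma big_energy_index L k (f : nat -> X -> X -> R) :
  (forall p, p \in L -> 0 <= p.1) ->
  \sum_(i <- energy_index L k) energy_coef i * f i.1 i.2.1.2 i.2.2.2 =
  \sum_(0 <= j < k.+1) tau ^+ j *
    (\sum_(p <- L) p.1 * \sum_(q <- L) q.1 * f j p.2 q.2).
Proof.
move=> L0; rewrite big_allpairs /index_iota subn0; apply: eq_bigr => j _.
rewrite big_allpairs mulr_sumr; apply: eq_big_seq => p pL.
rewrite !mulr_sumr; apply: eq_big_seq => q qL.
by rewrite /energy_coef /= !ger0_norm ?L0//; ring.
Qed.

Lemma sum_classes (L : seq (R * X)) (f : R * X -> nat) N (G : nat -> R * X -> R) :
  (forall p, p \in L -> (f p < N)%N) ->
  \sum_(0 <= i < N) \sum_(p <- L | f p == i) G i p = \sum_(p <- L) G (f p) p.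
Proof.
move=> fN; rewrite (exchange_big_dep predT)//=; apply: eq_big_seq => p pL.
by under eq_bigl do rewrite eq_sym; rewrite big_nat1_eq fN.
Qed.

(* The arithmetic-geometric mean inequality [2 m <= la t^-1 + la^-1 t m^2] for the
   mass m of each class, with [t = tau^(jj i)]. *)
Lemma energy_lower (L : seq (R * X)) k (f : R * X -> nat) (jj : nat -> nat) N x e la :
  0 < tau -> 0 < la ->
  (forall p, p \in L -> 0 <= p.1) ->
  (forall p, p \in L -> (f p < N)%N) ->
  (forall i, (i < N)%N -> (jj i <= k)%N) ->
  (forall p q, p \in L -> q \in L -> f p = f q -> S (jj (f p)) p.2 q.2 x) ->
  \sum_(0 <= i < N) tau ^- jj i <= e ->
  2 * \sum_(p <- L) p.1 <= la * e + la^-1 * \sum_(0 <= j < k.+1) tau ^+ j *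
    (\sum_(p <- L) p.1 * \sum_(q <- L) q.1 * \1_(S j p.2 q.2) x).
Proof.
move=> tau0 la0 L0 fN jk fS se.
set E := \sum_(0 <= j < k.+1) _.
pose m i := \sum_(p <- L | f p == i) p.1.
(* Of the energy, only pairs within one class are kept, each at the single scale [jj] of its
   class. *)
have mE : \sum_(0 <= i < N) tau ^+ jj i * m i ^+ 2 <= E.
  have -> : \sum_(0 <= i < N) tau ^+ jj i * m i ^+ 2 =
      \sum_(p <- L) p.1 * \sum_(q <- L) q.1 * ((f q == f p)%:R * tau ^+ jj (f p)).
    rewrite -(sum_classes (fun i p => p.1 * \sum_(q <- L) q.1 * ((f q == i)%:R * tau ^+ jj i)) fN).
    apply: eq_bigr => i _; rewrite -mulr_suml expr2 mulrCA; congr (_ * _).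
    rewrite /m mulr_sumr big_mkcond; apply: eq_bigr => q _.
    by case: (f q == i); rewrite ?mul1r ?mul0r ?mulr0// mulrC.
  rewrite /E; under [leRHS]eq_bigr do rewrite mulr_sumr.
  rewrite exchange_big /= big_seq [leRHS]big_seq; apply: ler_sum => p pL.
  under [leRHS]eq_bigr do rewrite mulrCA mulr_sumr.
  rewrite -mulr_sumr; apply: ler_wpM2l; first exact: L0.
  rewrite exchange_big /= big_seq [leRHS]big_seq; apply: ler_sum => q qL.
  under [leRHS]eq_bigr do rewrite mulrCA.
  rewrite -mulr_sumr; apply: ler_wpM2l; first exact: L0.
  have [fqp|_] := eqVneq (f q) (f p); last first.
    by rewrite mul0r sumr_ge0// => j _; rewrite mulr_ge0// exprn_ge0// ltW.
  rewrite mul1r (bigID (pred1 (jj (f p)))) /= big_nat1_eq /= ltnS jk ?fN//.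
  rewrite indicE mem_set ?mulr1 ?lerDl; last by apply: fS.
  by apply: sumr_ge0 => j _; rewrite mulr_ge0// exprn_ge0// ltW.
have -> : \sum_(p <- L) p.1 = \sum_(0 <= i < N) m i.
  by rewrite /m (sum_classes (fun _ p => p.1) fN).
apply: (@le_trans _ _ (la * \sum_(0 <= i < N) tau ^- jj i +
    la^-1 * \sum_(0 <= i < N) tau ^+ jj i * m i ^+ 2)); last first.
  by apply: lerD; apply: ler_wpM2l => //; rewrite ?invr_ge0 ltW.
rewrite !mulr_sumr -big_split; apply: ler_sum => i _ /=.
have t0 : 0 < tau ^+ jj i by rewrite exprn_gt0.
move: (tau ^+ jj i) t0 => t t0; rewrite -subr_ge0.
have -> : la * t^-1 + la^-1 * (t * m i ^+ 2) - 2 * m i =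
  la^-1 * t * (m i - la / t) ^+ 2 by field; rewrite !gt_eqF.
by apply: mulr_ge0; [apply: mulr_ge0; rewrite ?invr_ge0; exact: ltW|exact: sqr_ge0].
Qed.

End EnergySum.

(** * Vertical projections *)

Section HeisenbergGeometry.
Context {R : realType} {n : nat}.
Implicit Types (z w : 'rV[R]_(n + n)) (V : {vspace 'rV[R]_(n + n)}) (p q : heis R n).

Lemma omegaDl z z' w : omega (z + z') w = omega z w + omega z' w.
Proof. by rewrite /omega -big_split /=; apply: eq_bigr => j _; rewrite !mxE; ring. Qed.

Lemma omegaDr z w w' : omega z (w + w') = omega z w + omega z w'.
Proof. by rewrite /omega -big_split /=; apply: eq_bigr => j _; rewrite !mxE; ring. Qed.

Lemma omegaNl z w : omega (- z) w = - omega z w.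
Proof. by rewrite /omega -sumrN; apply: eq_bigr => j _; rewrite !mxE; ring. Qed.

Lemma omegaNr z w : omega z (- w) = - omega z w.
Proof. by rewrite /omega -sumrN; apply: eq_bigr => j _; rewrite !mxE; ring. Qed.

Lemma omegavv z : omega z z = 0.
Proof. by rewrite /omega big1// => j _; ring. Qed.

Lemma omega_le z w : `|omega z w| <= (2 * n)%:R * (enorm z * enorm w).
Proof.
apply: le_trans (ler_norm_sum _ _ _) _.
apply: (@le_trans _ _ (\sum_(j < n) 2 * (enorm z * enorm w))); last first.
  by rewrite sumr_const card_ord -[leLHS]mulr_natl mulrA -natrM [(n * 2)%N]mulnC.
apply: ler_sum => j _; apply: le_trans (ler_normB _ _) _; rewrite !normrM.
rewrite mulr_natl mulr2n; apply: lerD; apply: ler_pM => //;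
by rewrite !mxE; exact: coord_le_enorm.
Qed.

Definition heis_edist p q : R := enorm (p.1 - q.1) + `|p.2 - q.2|.

Lemma heis_edistC p q : heis_edist p q = heis_edist q p.
Proof. by rewrite /heis_edist enormBC distrC. Qed.

Lemma heis_edist_triangle q p r : heis_edist p r <= heis_edist p q + heis_edist q r.
Proof.
rewrite /heis_edist addrACA; apply: lerD; last exact: ler_distD.
have -> : p.1 - r.1 = (p.1 - q.1) + (q.1 - r.1) by rewrite addrA subrK.
exact: enormD.
Qed.

Lemma vert_projL1 V p : (vert_projL V p).1 = p.1 - orth_proj V p.1.
Proof. by []. Qed.

Lemma vert_projL2 V p : (vert_projL V p).2 = p.2 - 2^-1 * omega p.1 (orth_proj V p.1).
Proof. by rewrite /vert_projL /heis_mul /= omegaNr oppr0 addr0 mulrN. Qed.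

Variable M : R.
Hypothesis M1 : 1 <= M.

Let M0 : 0 <= M. Proof. exact: le_trans M1. Qed.

Definition box : set (heis R n) :=
  [set p : heis R n | (forall j, `|p.1 0 j| <= M) /\ `|p.2| <= M].

(** On the box, [lip - 1] is a Lipschitz constant, uniform in [V], of half of omega(z, pi_V z): the
    constant of [omega_le] times the bound on Euclidean norms in the box. *)
Definition lip : R := 1 + (2 * n)%:R * ((n + n)%:R * M).

Lemma lip_ge1 : 1 <= lip.
Proof. by rewrite lerDl !mulr_ge0. Qed.

Lemma box_enorm p : box p -> enorm p.1 <= (n + n)%:R * M.
Proof. by move=> [pM _]; exact: enorm_le_coord. Qed.

Lemma omega_proj_dist V p q : box p -> box q ->
  `|2^-1 * omega p.1 (orth_proj V p.1) - 2^-1 * omega q.1 (orth_proj V q.1)|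
  <= (lip - 1) * enorm (p.1 - q.1).
Proof.
move=> pM qM.
have -> : 2^-1 * omega p.1 (orth_proj V p.1) - 2^-1 * omega q.1 (orth_proj V q.1) =
    2^-1 * (omega (p.1 - q.1) (orth_proj V p.1) + omega q.1 (orth_proj V (p.1 - q.1))).
  by rewrite linearB omegaDl omegaDr omegaNl omegaNr; ring.
rewrite normrM ger0_norm ?invr_ge0//.
have h1 := omega_le (p.1 - q.1) (orth_proj V p.1).
have h2 := omega_le q.1 (orth_proj V (p.1 - q.1)).
set e := enorm (p.1 - q.1) in h1 *; have e0 : 0 <= e := enorm_ge0 _.
have b1 : enorm (orth_proj V p.1) <= (n + n)%:R * M.
  exact: le_trans (enorm_orth_proj _ _) (box_enorm pM).
have b2 := box_enorm qM.
have b3 : enorm (orth_proj V (p.1 - q.1)) <= e by exact: enorm_orth_proj.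
have b4 : e * enorm (orth_proj V p.1) <= e * ((n + n)%:R * M) by exact: ler_wpM2l.
have b5 : enorm q.1 * enorm (orth_proj V (p.1 - q.1)) <= ((n + n)%:R * M) * e.
  by apply: ler_pM; rewrite ?enorm_ge0.
have N0 : 0 <= (2 * n)%:R :> R by [].
have b6 := ler_wpM2l N0 b4; have b7 := ler_wpM2l N0 b5.
have := ler_normD (omega (p.1 - q.1) (orth_proj V p.1)) (omega q.1 (orth_proj V (p.1 - q.1))).
rewrite /lip; lra.
Qed.

Lemma vert_projL_edist_le V p q : box p -> box q ->
  heis_edist (vert_projL V p) (vert_projL V q) <= lip * heis_edist p q.
Proof.
move=> pM qM; rewrite /heis_edist vert_projL1 vert_projL1 !vert_projL2.
have -> : p.1 - orth_proj V p.1 - (q.1 - orth_proj V q.1) =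
    (p.1 - q.1) - orth_proj V (p.1 - q.1).
  by rewrite (linearB (orth_proj V)) !opprB addrACA [X in _ + X]addrC addrACA.
have h0 := omega_proj_dist V pM qM.
have h1 : enorm (p.1 - q.1 - orth_proj V (p.1 - q.1)) <= enorm (p.1 - q.1).
  by have := orth_proj_min (p.1 - q.1) (mem0v V); rewrite subr0.
move: h0; set a := 2^-1 * _; set b := 2^-1 * _ => h0.
have -> : p.2 - a - (q.2 - b) = (p.2 - q.2) - (a - b) by ring.
have h2 := ler_normB (p.2 - q.2) (a - b).
have l1 := lip_ge1; have := normr_ge0 (p.2 - q.2).
nra.
Qed.

Lemma vert_projL_edist_ge V p q (r : R) : box p -> box q ->
  heis_edist (vert_projL V p) (vert_projL V q) <= r ->
  enorm (p.1 - q.1 - orth_proj V (p.1 - q.1)) <= r /\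
  `|p.2 - q.2| <= lip * (r + enorm (p.1 - q.1)).
Proof.
move=> pM qM; rewrite /heis_edist vert_projL1 vert_projL1 !vert_projL2.
have -> : p.1 - orth_proj V p.1 - (q.1 - orth_proj V q.1) =
    (p.1 - q.1) - orth_proj V (p.1 - q.1).
  by rewrite (linearB (orth_proj V)) !opprB addrACA [X in _ + X]addrC addrACA.
have h0 := omega_proj_dist V pM qM.
move: h0; set a := 2^-1 * _; set b := 2^-1 * _ => h0.
have := enorm_ge0 (p.1 - q.1 - orth_proj V (p.1 - q.1)).
have := normr_ge0 (p.2 - a - (q.2 - b)) => h1 h2 h3; split; first lra.
have -> : p.2 - q.2 = (p.2 - a - (q.2 - b)) + (a - b) by ring.
have h4 := ler_normD (p.2 - a - (q.2 - b)) (a - b).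
have l1 := lip_ge1; have := enorm_ge0 (p.1 - q.1); nra.
Qed.

Lemma koranyi_norm_le p (r : R) : 0 <= r -> koranyi_norm p <= r ->
  enorm p.1 <= r /\ 4 * `|p.2| <= r ^+ 2.
Proof.
move=> r0 pr; have e0 := enorm_ge0 p.1.
have s0 : 0 <= enorm p.1 ^+ 4 + 16 * p.2 ^+ 2.
  by rewrite addr_ge0 ?exprn_ge0// mulr_ge0// sqr_ge0.
have : enorm p.1 ^+ 4 + 16 * p.2 ^+ 2 <= r ^+ 4.
  have -> : enorm p.1 ^+ 4 + 16 * p.2 ^+ 2 = koranyi_norm p ^+ 4.
    by rewrite /koranyi_norm -[RHS]powR_mulrn ?powR_ge0// -powRrM mulVf// powRr1.
  by apply: lerXn2r; rewrite ?nnegrE// powR_ge0.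
move=> h; split.
  rewrite -(@ler_pXn2r _ 4)// ?nnegrE//; apply: le_trans h.
  by rewrite lerDl mulr_ge0// sqr_ge0.
rewrite -(@ler_pXn2r _ 2)// ?nnegrE ?mulr_ge0 ?sqr_ge0//.
rewrite -exprM exprMn -normrX ger0_norm ?sqr_ge0//; apply: le_trans h.
have -> : (4 ^+ 2 : R) = 16 by rewrite -natrX.
by rewrite lerDr exprn_ge0.
Qed.

(** The constant comes from 1 + 16 <= 3^4. *)
Lemma koranyi_norm_ge p (r : R) : 0 <= r -> enorm p.1 <= r -> `|p.2| <= r ^+ 2 ->
  koranyi_norm p <= 3 * r.
Proof.
move=> r0 p1 p2; rewrite /koranyi_norm.
have : enorm p.1 ^+ 4 + 16 * p.2 ^+ 2 <= (3 * r) ^+ 4.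
  have h1 : enorm p.1 ^+ 4 <= r ^+ 4 by apply: lerXn2r; rewrite ?nnegrE ?enorm_ge0.
  have h2 : p.2 ^+ 2 <= r ^+ 4.
    rewrite -[p.2 ^+ 2]ger0_norm ?sqr_ge0// normrX (_ : r ^+ 4 = (r ^+ 2) ^+ 2).
      by apply: lerXn2r; rewrite ?nnegrE ?sqr_ge0.
    by rewrite -exprM.
  have -> : (3 * r) ^+ 4 = 81 * r ^+ 4 by rewrite exprMn -natrX.
  have : 0 <= r ^+ 4 by rewrite exprn_ge0.
  by lra.
move=> h; have r3 : 0 <= 3 * r by rewrite mulr_ge0.
have -> : 3 * r = ((3 * r) ^+ 4) `^ 4^-1.
  by rewrite -powR_mulrn// -powRrM mulfV// powRr1.
by apply: ge0_ler_powR; rewrite ?nnegrE ?invr_ge0 ?exprn_ge0 ?mulr_ge0//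
  addr_ge0 ?exprn_ge0 ?enorm_ge0// mulr_ge0// sqr_ge0.
Qed.

(** The group law twists the height difference by half of omega(b, a - b), which is O(r) since
    projections of box points are bounded; the rest of the height difference is at most r^2 / 4,
    hence O(r) because r <= 1. *)
Lemma koranyi_dist_edist V p q (r : R) : box p -> box q -> 0 <= r <= 1 ->
  koranyi_dist (vert_projL V p) (vert_projL V q) <= r ->
  heis_edist (vert_projL V p) (vert_projL V q) <= (1 + lip) * r.
Proof.
move=> pM qM /andP[r0 r1] /(koranyi_norm_le r0).
set a := vert_projL V p; set b := vert_projL V q.
rewrite /heis_mul /heis_inv /=.
have -> : - b.1 + a.1 = a.1 - b.1 by rewrite addrC.
have ob : omega (- b.1) a.1 = - omega b.1 (a.1 - b.1).
  by rewrite omegaDr omegaNr omegavv oppr0 addr0 omegaNl.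
rewrite ob => -[h1 h2]; rewrite /heis_edist.
have b1 : enorm b.1 <= (n + n)%:R * M.
  rewrite /b vert_projL1; have := orth_proj_min q.1 (mem0v V); rewrite subr0.
  by move=> /le_trans; apply; exact: box_enorm.
have h3 := omega_le b.1 (a.1 - b.1).
have b2 : enorm b.1 * enorm (a.1 - b.1) <= ((n + n)%:R * M) * r.
  by apply: ler_pM; rewrite ?enorm_ge0.
have b3 := ler_wpM2l (ler0n R (2 * n)) b2.
have -> : a.2 - b.2 = (- b.2 + a.2 + 2^-1 * - omega b.1 (a.1 - b.1)) +
  2^-1 * omega b.1 (a.1 - b.1) by ring.
have h4 := ler_normD (- b.2 + a.2 + 2^-1 * - omega b.1 (a.1 - b.1))
  (2^-1 * omega b.1 (a.1 - b.1)).
rewrite [X in _ <= _ + X]normrM ger0_norm ?invr_ge0// in h4.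
have rr : r ^+ 2 <= r by rewrite expr2 ler_piMl.
by have := normr_ge0 (omega b.1 (a.1 - b.1)); rewrite /lip; lra.
Qed.

End HeisenbergGeometry.

Section Coordinates.
Context {R : realType} {n : nat} (M : R).
Hypothesis M1 : 1 <= M.

Definition heis_coord (i : nat) (p : heis R n) : R :=
  if insub i is Some j then p.1 0 (j : 'I_(n + n)) else p.2.

(** Dividing by 2M + 1 instead of 2M keeps the values strictly below 1, as the binary expansion
    requires. *)
Definition box_coord i (p : heis R n) : R := (heis_coord i p + M) / (2 * M + 1).

Lemma heis_coord1 (j : 'I_(n + n)) p : heis_coord j p = p.1 0 j.
Proof. by rewrite /heis_coord valK. Qed.

Lemma heis_coord2 p : heis_coord (n + n) p = p.2.
Proof. by rewrite /heis_coord insubF// ltnn. Qed.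

Lemma box_coord_bounds p i : box M p -> 0 <= box_coord i p < 1.
Proof.
move=> [p1 p2]; have : `|heis_coord i p| <= M.
  by rewrite /heis_coord; case: insubP => [j _ _|_]; [exact: p1|exact: p2].
rewrite ler_norml => /andP[h1 h2]; have h := M1.
by rewrite /box_coord divr_ge0 ?ltr_pdivrMr ?mul1r//=; lra.
Qed.

Lemma coord_closeP k p q :
  coord_close (n + n).+1 box_coord k p q ->
  enorm (p.1 - q.1) <= (n + n)%:R * ((2 * M + 1) * 2^-1 ^+ k) /\
  `|p.2 - q.2| <= (2 * M + 1) * 2^-1 ^+ k.
Proof.
have h := M1; have M21 : 0 < 2 * M + 1 by lra.
have e0 : 0 <= (2^-1 : R) ^+ k by rewrite exprn_ge0.
move=> /forallP pq.
have co (i : 'I_(n + n).+1) : `|heis_coord i p - heis_coord i q| <= (2 * M + 1) * 2^-1 ^+ k.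
  have := pq i; rewrite /box_coord -mulrBl opprD addrACA subrr addr0 normrM.
  by rewrite [X in _ * X]ger0_norm ?invr_ge0 ?(ltW M21)// ler_pdivrMr// mulrC.
split.
  apply: enorm_le_coord => [|j]; first by rewrite mulr_ge0// ltW.
  by have := co (widen_ord (leqnSn _) j); rewrite /= !heis_coord1 !mxE.
by have := co ord_max; rewrite /= !heis_coord2.
Qed.

Lemma not_coord_close k p q :
  ~~ coord_close (n + n).+1 box_coord k.+1 p q ->
  2^-1 ^+ k <= enorm (p.1 - q.1) \/ 2^-1 ^+ k <= `|p.2 - q.2|.
Proof.
have h := M1; have M21 : 0 < 2 * M + 1 by lra.
have e0 : 0 <= (2^-1 : R) ^+ k by rewrite exprn_ge0.
move=> npq; have [i0] : exists i : 'I_(n + n).+1,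
    ~~ (`|box_coord i p - box_coord i q| <= 2^-1 ^+ k.+1).
  by apply/existsP; rewrite -negb_forall.
rewrite -ltNge /box_coord -mulrBl opprD addrACA subrr addr0 normrM.
rewrite [X in _ * X]ger0_norm ?invr_ge0 ?(ltW M21)// ltr_pdivlMr// exprS => hi.
(* The factor 2M + 1 >= 2 absorbs the passage from [k.+1] to [k]. *)
have {}hi : 2^-1 ^+ k <= `|heis_coord i0 p - heis_coord i0 q|.
  by apply: ltW; apply: le_lt_trans hi; nra.
move: hi; rewrite /heis_coord; case: insubP => [j _ _ hi|_]; last by right.
by left; apply: le_trans hi _; have := coord_le_enorm (p.1 - q.1) j; rewrite !mxE.
Qed.

End Coordinates.

(** * Planes that bring two points together *)

Section CollisionSets.
Context {R : realType} {n m : nat} {hmn : (m <= n)%N}.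
Hypothesis hm : (1 <= m)%N.
Variables (mu : probability (borelType (isoGrass R hmn)) R).
Hypothesis hmu : unitary_invariant mu.
Variable M : R.
Hypothesis M1 : 1 <= M.

(* Contains every plane whose vertical projection brings p and q within
   distance [2^-j]. *)
Definition collision (j : nat) (p q : heis R n) : set (borelType (isoGrass R hmn)) :=
  if `|p.2 - q.2| <= lip (n := n) M * (2^-1 ^+ j + enorm (p.1 - q.1))
  then close_planes (p.1 - q.1) (2^-1 ^+ j) else set0.

Lemma measurable_collision j p q : measurable (collision j p q).
Proof.
by rewrite /collision; case: ifP => _; [exact: measurable_close_planes|exact: measurable0].
Qed.

Lemma collisionP j p q (V : isoGrass R hmn) : box M p -> box M q ->
  heis_edist (vert_projL (val V) p) (vert_projL (val V) q) <= 2^-1 ^+ j ->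
  collision j p q V.
Proof.
move=> pM qM /(vert_projL_edist_ge M1 pM qM)[h1 h2].
by rewrite /collision h2 close_planesE.
Qed.

(** Let 2^-i be the last scale, down to 2^-j, at which p and q are close, and kap = [lip M]. If i <
    j, either the horizontal difference is at least 2^-i / (2 kap), and the measure estimate
    applies, or the vertical one is at least 2^-i, and then a nonempty collision set forces 2 kap
    2^-(j - i) >= 1, where the trivial bound 1 suffices, as it does for i = j. The term of index i
    of the sum carries the whole bound. *)
Lemma pr_collision_le : exists2 C : R, 0 < C & forall j p q, box M p -> box M q ->
  pr mu (collision j p q) <= C * \sum_(0 <= i < j.+1)
    (2^-1 ^+ (n + n - m)) ^+ (j - i) * (coord_close (n + n).+1 (box_coord M) i p q)%:R.
Proof.
have [C C0 CP] := pr_close_planes_le hm hmu.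
set be := (n + n - m)%N in CP *.
have kap1 := lip_ge1 (n := n) M1; set kap := lip M in kap1.
have kap0 : 0 < kap by lra.
pose D := (1 + C) * (2 * kap) ^+ be.
have D1 : 1 <= D.
  rewrite -[leLHS]mulr1; apply: ler_pM => //; first by rewrite lerDl ltW.
  by apply: exprn_ege1; lra.
have D0 : 0 < D by lra.
exists D => // j p q pM qM.
have half0 i : 0 < (2^-1 : R) ^+ i by rewrite exprn_gt0.
have c0 : coord_close (n + n).+1 (box_coord M) 0 p q.
  apply/forallP => i; rewrite expr0.
  have /andP[p0 p1] := box_coord_bounds M1 i pM.
  have /andP[q0 q1] := box_coord_bounds M1 i qM.
  by rewrite ler_norml; apply/andP; split; lra.
pose P i := (i <= j)%N && coord_close (n + n).+1 (box_coord M) i p q.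
have exP : exists i, P i by exists 0%N; rewrite /P.
have ubP i : P i -> (i <= j)%N by case/andP.
case: (ex_maxnP exP ubP) => i /andP[ij ci] imax.
suff prle : pr mu (collision j p q) <= D * (2^-1 ^+ be) ^+ (j - i).
  apply: (le_trans prle); rewrite ler_pM2l// (bigID (pred1 i)) /= big_nat1_eq /= ltnS ij ci mulr1.
  by rewrite lerDl sumr_ge0// => l _; rewrite mulr_ge0// !exprn_ge0.
have mS := measurable_collision j p q.
rewrite exprAC; set e := 2^-1 ^+ (j - i).
have e0 : 0 < e by exact: half0.
have eE : 2^-1 ^+ j = e * 2^-1 ^+ i by rewrite /e -exprD subnK.
have trivial : 1 <= 2 * kap * e -> pr mu (collision j p q) <= D * e ^+ be.
  move=> h; apply: le_trans (pr_le1 mu mS) _.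
  rewrite /D -mulrA -exprMn -[leLHS]mulr1; apply: ler_pM => //; first by rewrite lerDl ltW.
  exact: exprn_ege1.
have [iE|ij'] := eqVneq i j.
  apply: trivial; rewrite /e iE subnn expr0; lra.
have nc : ~~ coord_close (n + n).+1 (box_coord M) i.+1 p q.
  apply/negP => c; have := imax i.+1; rewrite /P c andbT ltn_neqAle ij' ij => /(_ isT).
  by rewrite ltnn.
have [zbig|zsmall] := leP (2^-1 ^+ i / (2 * kap)) (enorm (p.1 - q.1)).
  have z0 : 0 < enorm (p.1 - q.1).
    by apply: lt_le_trans zbig; rewrite divr_gt0// mulr_gt0.
  apply: (@le_trans _ _ (pr mu (close_planes (hmn := hmn) (p.1 - q.1) (2^-1 ^+ j)))).
    apply: pr_mono => //; first exact: measurable_close_planes.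
    by move=> V; rewrite /collision; case: ifP.
  apply: le_trans (CP _ _ _ (half0 j)) _; first by rewrite -enorm_gt0.
  rewrite /D -mulrA -exprMn; apply: ler_pM; rewrite ?(ltW C0)//.
  - by rewrite exprn_ge0// divr_ge0 ?enorm_ge0// ltW.
  - by rewrite lerDr.
  apply: lerXn2r; rewrite ?nnegrE.
  - by rewrite divr_ge0 ?enorm_ge0// ltW.
  - by rewrite !mulr_ge0 ?ltW.
  rewrite ler_pdivrMr// eE; rewrite ler_pdivrMr ?mulr_gt0// in zbig.
  have := ler_wpM2l (ltW e0) zbig; nra.
have [h|hz] := not_coord_close M1 nc.
  exfalso; have : 2^-1 ^+ i < 2^-1 ^+ i / (2 * kap) by apply: le_lt_trans zsmall.
  rewrite ltr_pdivlMr ?mulr_gt0// => h'; have := half0 i; nra.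
rewrite /collision -/kap; case: ifPn => [hp|_]; last first.
  by rewrite /pr measure0 mulr_ge0 ?exprn_ge0 ?ltW.
move: trivial; rewrite /collision hp; apply.
rewrite eE in hp; rewrite ltr_pdivlMr ?mulr_gt0// in zsmall.
have h1 := le_trans hz hp; have := half0 i.
move: (2^-1 ^+ i) (enorm _) h1 zsmall => x y h1 h2 x0; nra.
Qed.

End CollisionSets.

Section BoxCompact.
Context {R : realType} {n : nat}.

Lemma compact_box (M : R) : compact (box (n := n) M).
Proof.
rewrite (_ : box M = [set z : 'rV[R]_(n + n) | forall j, `[- M, M]%classic (z 0 j)]
    `*` `[- M, M]%classic).
  apply: compact_setX; last exact: segment_compact.
  by apply: (@rV_compact _ _ (fun=> `[- M, M]%classic)) => j; exact: segment_compact.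
apply/seteqP; split=> p; rewrite /box /= !in_itv /= -ler_norml => -[h1 h2]; split=> // j.
  by rewrite in_itv /= -ler_norml.
by have := h1 j; rewrite in_itv /= -ler_norml.
Qed.

Lemma nbhs_edist (x : heis R n) (r : R) : 0 < r ->
  nbhs x [set p | heis_edist p x < r].
Proof.
move=> r0; apply/nbhs_ballP; pose e := r / ((n + n).+1%:R * 2).
have e0 : 0 < e by rewrite divr_gt0// mulr_gt0.
exists e => //= p [/= [_ b1] b2]; rewrite /heis_edist.
have h1 : enorm (p.1 - x.1) <= (n + n)%:R * e.
  apply: enorm_le_coord; first exact: ltW.
  move=> j; rewrite !mxE distrC; apply: ltW; exact: b1.
have h2 : `|p.2 - x.2| < e by rewrite distrC; exact: b2.
have -> : r = (n + n).+1%:R * e + (n + n).+1%:R * e.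
  by rewrite /e; move: (n + n)%N => k; field; rewrite gt_eqF//; have := ler0n R k; lra.
rewrite -natr1; have h3 : 0 <= (n + n)%:R * e by rewrite mulr_ge0// ltW.
lra.
Qed.

Lemma nbhs_edist_sub (x : heis R n) (U : set (heis R n)) : nbhs x U ->
  exists2 e : R, 0 < e & forall p, heis_edist p x < e -> U p.
Proof.
move=> /nbhs_ballP[e /= e0 eU]; exists e => // p px; apply: eU; split=> /=.
  split=> // i j; rewrite (ord1 i); apply: le_lt_trans px.
  have := coord_le_enorm (x.1 - p.1) j; rewrite !mxE enormBC => h.
  by apply: le_trans h _; rewrite lerDl.
rewrite /ball /=; apply: le_lt_trans px; rewrite distrC.
by rewrite lerDr enorm_ge0.
Qed.

Lemma box_cluster (M : R) (x : nat -> heis R n) : (forall k, box M (x k)) ->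
  exists2 l, box M l & forall r k0, 0 < r -> exists2 k, (k0 <= k)%N & heis_edist (x k) l < r.
Proof.
move=> xM; have := @compact_box M (x @ \oo) _.
case; first by exists 0%N => // k _; exact: xM.
move=> l [lM lcl]; exists l => // r k0 r0.
have [|y [[k /= kk <-] yl]] := lcl [set x k | k in [set k | (k0 <= k)%N]] _ _ (nbhs_edist l r0).
  by exists k0 => // k kk; exists k.
by exists k.
Qed.

End BoxCompact.

Section Scales.
Context {R : realType}.

Lemma dyadic_scale (x : R) : 0 < x <= 1 -> exists j, x <= 2^-1 ^+ j < 2 * x.
Proof.
move=> /andP[x0 x1].
have ex : exists j, (2^-1 : R) ^+ j < x.
  exists (Num.truncn x^-1).+1; rewrite exprVn invf_plt ?posrE ?exprn_gt0//.
  have x0' : 0 <= x^-1 by rewrite invr_ge0 ltW.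
  have /andP[_ h] := truncn_itv x0'; apply: lt_trans h _.
  by rewrite -natrX ltr_nat ltn_expl.
case: (ex_minnP ex) => -[|j]; first by rewrite expr0 ltNge x1.
move=> jx jmin; exists j; apply/andP; split.
  by rewrite leNgt; apply/negP => /jmin; rewrite ltnn.
by move: jx; rewrite exprS; lra.
Qed.

Lemma powR_exprV (t : R) j : ((2 `^ t) ^+ j)^-1 = (2^-1 ^+ j) `^ t.
Proof.
rewrite -powR_mulrn ?powR_ge0// -powRrM mulrC powRrM powR_mulrn//.
by rewrite exprVn -[in RHS]powR_inv1 ?exprn_ge0// -powRrM mulN1r powRN.
Qed.

Lemma powR_le (t x y : R) : 0 <= t -> 0 <= x <= y -> x `^ t <= y `^ t.
Proof.
move=> t0 /andP[x0 xy]; apply: ge0_ler_powR; rewrite ?nnegrE//.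
exact: le_trans xy.
Qed.

(* The strictly positive scales leave room for neighbourhoods of the covering
   sets, even of those of diameter 0. *)
Lemma dyadic_cover_scales (t C eps : R) (de : nat -> R) :
  0 < t -> 1 <= C -> 0 < eps -> eps <= (2 * C)^-1 ->
  (forall i, 0 <= de i <= eps) -> (forall N, \sum_(0 <= i < N) de i `^ t <= eps) ->
  exists jj : nat -> nat,
    (forall i, 2 * C * de i <= 2^-1 ^+ jj i) /\
    (forall N, \sum_(0 <= i < N) (2 `^ t) ^- jj i <= ((4 * C) `^ t + 1) * eps).
Proof.
move=> t0 C1 e0 eC deP deS.
have C0 : 0 < 2 * C by lra.
(* Chosen so that 2 xi_k raised to the power t is eps / 2^(k + 1), which sums to at most eps. *)
pose xi (k : nat) := (eps * 2^-1 ^+ k.+1) `^ t^-1 / 2.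
have e1 : eps <= 1.
  apply: le_trans eC _; rewrite invf_le1//; lra.
have h0 (k : nat) : 0 < eps * 2^-1 ^+ k.+1 by rewrite mulr_gt0// exprn_gt0.
have xi0 k : 0 < xi k by rewrite divr_gt0// powR_gt0.
have xi1 k : xi k <= 1.
  rewrite ler_pdivrMr// mul1r; apply: (@le_trans _ _ 1); last by rewrite ler1n.
  apply: (@le_trans _ _ (1 `^ t^-1)); last by rewrite powR1.
  apply: powR_le; first by rewrite invr_ge0 ltW.
  rewrite (ltW (h0 _)) /=; rewrite -[leRHS]mulr1; apply: ler_pM => //; first exact: ltW.
  by apply: exprn_ile1; lra.
pose x k := Num.max (2 * C * de k) (xi k).
have x01 k : 0 < x k <= 1.
  rewrite lt_max xi0 orbT ge_max xi1 andbT /=; have /andP[_ h] := deP k.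
  have := ler_wpM2l (ltW C0) (le_trans h eC); rewrite mulfV ?gt_eqF//.
have /boolp.choice[jj jjP] k := dyadic_scale (x01 k).
exists jj; split=> [k|N].
  by have /andP[h _] := jjP k; apply: le_trans h; rewrite le_max lexx.
apply: (@le_trans _ _ (\sum_(0 <= k < N) ((4 * C) `^ t * de k `^ t + eps * 2^-1 ^+ k.+1))).
  apply: ler_sum => k _; rewrite powR_exprV.
  have /andP[_ h] := jjP k; have /andP[d0 _] := deP k.
  have x0 : 0 <= x k by have /andP[/ltW] := x01 k.
  apply: (@le_trans _ _ ((2 * x k) `^ t)).
    by apply: powR_le; [exact: ltW|rewrite exprn_ge0//= ltW].
  rewrite -powRM//; last by lra.
  have xi2 : (2 * xi k) `^ t = eps * 2^-1 ^+ k.+1.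
    have -> : 2 * xi k = (eps * 2^-1 ^+ k.+1) `^ t^-1 by rewrite /xi; field.
    by rewrite -powRrM mulVf ?gt_eqF// powRr1// ltW.
  rewrite /x maxEle; case: ifP => _.
    by rewrite xi2 lerDr powR_ge0.
  have -> : 2 * (2 * C * de k) = 4 * C * de k by ring.
  by rewrite lerDl ltW.
rewrite big_split /= [leRHS]mulrDl mul1r; apply: lerD.
  by rewrite -mulr_sumr; apply: ler_wpM2l; [exact: powR_ge0|exact: deS].
rewrite -[index_iota 0 N]/(iota 0 (N - 0)).
by apply: (@sum_half_le _ setT _ (ltW e0)) => //; exact: iota_uniq.
Qed.

End Scales.

(** * Covers of the projections *)

Section SmallCovers.
Context {R : realType} {n m : nat} {hmn : (m <= n)%N}.
Variables (M t a : R) (V : isoGrass R hmn).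
Hypotheses (M1 : 1 <= M) (t0 : 0 < t) (a0 : 0 < a).
Variables (C : heis R n -> (nat -> nat) -> Prop) (b : nat -> nat)
  (L : nat -> seq (R * heis R n)) (Bd : R).
Hypotheses (sC : sclosed C)
  (La : forall k, \sum_(p <- L k) p.1 = a)
  (LP : forall k p, p \in L k -> [/\ 0 <= p.1, bounded_slice C b k p.2 & box M p.2])
  (LE : forall k0, exists2 k, (k0 <= k)%N &
    \sum_(0 <= j < k.+1) (2 `^ t) ^+ j * (\sum_(p <- L k) p.1 *
      \sum_(q <- L k) q.1 * \1_(collision (hmn := hmn) M j p.2 q.2) V) <= Bd).

Let P := vert_projL (val V).

(* A limit point of points of the supports that escape the enlarged sets would
   lie in the Suslin set itself. *)
Lemma finite_subcover (E : nat -> set (heis R n)) (r : nat -> R) :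
  (forall i, 0 < r i) ->
  P @` ([set p | exists s, C p s] `&` box M) `<=` \bigcup_i E i ->
  exists N, forall k p, (N <= k)%N -> p \in L k ->
    exists2 i, (i < N)%N & exists2 q, box M q & E i (P q) /\ heis_edist (P p.2) (P q) < r i.
Proof.
move=> r0 cov; apply: contrapT => /forallNP none.
have /boolp.choice[x xP] N : exists x : heis R n, [/\ bounded_slice C b N x, box M x &
    forall i q, (i < N)%N -> box M q -> E i (P q) -> r i <= heis_edist (P x) (P q)].
  have /existsNP[k /existsNP[p /not_implyP[Nk /not_implyP[pL np]]]] := none N.
  have [p0 sp bp] := LP pL; exists p.2; split=> //.
    by case: sp => s sb Cs; exists s => // i iN; apply: sb; exact: leq_trans Nk.
  move=> i q iN bq Eq; rewrite leNgt; apply/negP => pq.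
  by apply: np; exists i => //; exists q.
have [l lM lim] := box_cluster (fun k => let: And3 _ h _ := xP k in h).
have [s Cs] : exists s, C l s.
  apply: (closure_bounded_slice sC (b := b)) => k U /nbhs_edist_sub[e e0 eU].
  have [k' kk' xl] := lim e k e0; exists (x k'); split; last exact: eU.
  have [[s sb Cs] _ _] := xP k'; exists s => // i ik; apply: sb; exact: leq_trans kk'.
have [i _ Ei] : (\bigcup_i E i) (P l) by apply: cov; exists l => //; split=> //; exists s.
have lip1 := lip_ge1 (n := n) M1; have lip0 : 0 < lip (n := n) M by lra.
have [k ik xl] := lim (r i / lip (n := n) M) i.+1 (divr_gt0 (r0 i) lip0).
have [_ xM far] := xP k; have := far i l ik lM Ei.
rewrite leNgt => /negP; apply.
apply: le_lt_trans (vert_projL_edist_le M1 (val V) xM lM) _.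
by rewrite mulrC -ltr_pdivlMr.
Qed.

(** Each atom of a late list is assigned to a member of the cover near its projection. Atoms with
    the same member collide at its scale, so by [energy_lower] a small cover would force an energy
    above the bound [Bd]. *)
Lemma no_small_cover : exists2 eps : R, 0 < eps &
  forall (E : nat -> set (heis R n)) (de : nat -> R),
    (forall i, 0 <= de i <= eps) ->
    (forall i x y, E i x -> E i y -> koranyi_dist x y <= de i) ->
    (forall N, \sum_(0 <= i < N) de i `^ t <= eps) ->
    ~ P @` ([set p | exists s, C p s] `&` box M) `<=` \bigcup_i E i.
Proof.
pose D := 1 + lip (n := n) M; have lip1 := lip_ge1 (n := n) M1.
have D1 : 1 <= D by rewrite /D; lra.
pose K := (4 * D) `^ t + 1.
have K0 : 0 < K by rewrite ltr_wpDl ?powR_ge0.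
pose B := `|Bd| + 1; have B0 : 0 < B by rewrite ltr_wpDl.
(* The first bound lets [dyadic_cover_scales] apply. The second makes the covering term of
   [energy_lower], with parameter B / a, at most a / 2; the energy term is at most a, against a left
   side of 2 a. *)
pose eps := Num.min (2 * D)^-1 (a ^+ 2 / (2 * B * K)).
have eps0 : 0 < eps.
  rewrite lt_min invr_gt0 divr_gt0 ?exprn_gt0 ?mulr_gt0//; lra.
exists eps => // E de deP Ede deS cov.
have epsD : eps <= (2 * D)^-1 by rewrite ge_min lexx.
have [jj [jjP jjS]] := dyadic_cover_scales t0 D1 eps0 epsD deP deS.
(* Two such radii use half of the scale, and [D * de i] at most the other half, by the factor 2 in
   [jjP]. *)
pose r i := (2^-1 : R) ^+ jj i / 4.
have r0 i : 0 < r i by rewrite divr_gt0// exprn_gt0.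
have [N NP] := finite_subcover r0 cov.
(* An index with bounded energy, past the compactness threshold [N] and fine enough to include the
   scales of the first [N] members. *)
have [k kN Ek] := LE (maxn N (\max_(i < N) jj i)).
have Nk : (N <= k)%N by apply: leq_trans kN; rewrite leq_maxl.
have jk i : (i < N)%N -> (jj i <= k)%N.
  move=> iN; apply: leq_trans kN; rewrite leq_max; apply/orP; right.
  exact: (leq_bigmax (F := fun i : 'I_N => jj i) (Ordinal iN)).
have /boolp.choice[f fP] (p : R * heis R n) : exists i, p \in L k -> (i < N)%N /\
    exists2 q, box M q & E i (P q) /\ heis_edist (P p.2) (P q) < r i.
  have [/(NP k p Nk)[i iN h]|_] := boolP (p \in L k); last by exists 0%N.
  by exists i => _.
have coll p q : p \in L k -> q \in L k -> f p = f q ->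
    collision (hmn := hmn) M (jj (f p)) p.2 q.2 V.
  move=> pL qL fpq; have [_ _ pM] := LP pL; have [_ _ qM] := LP qL.
  apply: collisionP => //; rewrite -/P.
  have [_ [p' p'M [Ep' pp']]] := fP p pL; have [_ [q' q'M [Eq' qq']]] := fP q qL.
  rewrite -fpq in Eq' qq'; set i := f p in Ep' pp' Eq' qq' *.
  have /andP[d0 d1] := deP i.
  have d2 : 0 <= de i <= 1.
    rewrite d0 /=; apply: le_trans d1 (le_trans epsD _).
    by rewrite invf_le1; lra.
  have pq' : heis_edist (P p') (P q') <= D * de i.
    exact: (koranyi_dist_edist M1 p'M q'M d2 (Ede _ _ _ Ep' Eq')).
  have h1 := heis_edist_triangle (P p') (P p.2) (P q.2).
  have h2 := heis_edist_triangle (P q') (P p') (P q.2).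
  rewrite (heis_edistC (P q') (P q.2)) in h2.
  have h3 := jjP i; rewrite /r in pp' qq'; lra.
have tau0 : 0 < 2 `^ t :> R by rewrite powR_gt0.
have la0 : 0 < B / a by rewrite divr_gt0.
have L0 p : p \in L k -> 0 <= p.1 by case/LP.
have fN p : p \in L k -> (f p < N)%N by move=> /fP[].
have := energy_lower tau0 la0 L0 fN jk coll (jjS N).
rewrite La -/K => h.
have : (B / a)^-1 * Bd <= a.
  rewrite invf_div mulrAC ler_pdivrMr// ler_pM2l//.
  by rewrite /B (le_trans (ler_norm _))// lerDl.
have h2 := ler_wpM2l (ltW (divr_gt0 a0 B0)) Ek.
have epsa : eps <= a ^+ 2 / (2 * B * K) by rewrite ge_min lexx orbT.
have h3 : B / a * (K * eps) <= a / 2.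
  apply: (@le_trans _ _ (B / a * (K * (a ^+ 2 / (2 * B * K))))).
    by rewrite !ler_pM2l.
  rewrite le_eqVlt; apply/orP; left; apply/eqP; field.
  by rewrite !gt_eqF.
rewrite invf_div in h *; move: h h2 h3.
move: (\sum_(0 <= j < k.+1) _) => S.
move=> h h2 h3 h4; have := le_trans h (lerD h3 (le_trans h2 h4)).
rewrite leNgt => /negP; apply.
have -> : a / 2 + a = 2 * a - a / 2 by field.
by rewrite ltrBlDr ltrDl divr_gt0.
Qed.

End SmallCovers.

(** * Covers of the projection to almost every plane *)

Section AlmostEveryPlane.
Context {R : realType} {n m : nat} {hmn : (m <= n)%N}.
Hypothesis hm : (1 <= m)%N.
Variables (mu : probability (borelType (isoGrass R hmn)) R).
Hypothesis hmu : unitary_invariant mu.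

(* The ratio of the weights of consecutive levels for which a cube of side
   [2^-k], at level [(2n+1)k], has weight [2^-(ks)]. *)
Definition ratio (s : R) : R := 2^-1 `^ (s / (n + n).+1%:R).

Lemma powR_half_lt (x y : R) : x < y -> (2^-1 : R) `^ y < 2^-1 `^ x.
Proof.
move=> xy; rewrite -(subrK x y) powRD; last by apply/implyP.
rewrite -[ltRHS]mul1r ltr_pM2r ?powR_gt0//.
apply: (@lt_le_trans _ _ (1 `^ (y - x))); last by rewrite powR1.
by apply: gt0_ltr_powR; rewrite ?subr_gt0 ?nnegrE//; lra.
Qed.

Lemma ratio01 s : 0 < s -> 0 < ratio s < 1.
Proof.
move=> s0; rewrite powR_gt0//= -[ltRHS](powRr0 2^-1).
by apply: powR_half_lt; rewrite divr_gt0.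
Qed.

Lemma ratio_exp s k : ratio s ^+ ((n + n).+1 * k) = (2^-1 `^ s) ^+ k.
Proof.
rewrite exprM; congr (_ ^+ k).
by rewrite -powR_mulrn ?powR_ge0// -powRrM divfK// pnatr_eq0.
Qed.

(** The exceptional planes come from Fatou's lemma alone, before any cover is considered. Afterwards
    [eps] may depend on the plane, and no uncountable union of null sets arises. *)
Lemma ae_no_small_cover (A : set (heis R n)) (M t s : R) :
  borel A -> 1 <= M -> 0 < t -> t < s -> s < (n + n - m)%:R ->
  0 < net_content (digits (n + n).+1 (box_coord M)) (ratio s) (A `&` box M) ->
  {ae mu, forall V : borelType (isoGrass R hmn), exists2 eps : R, 0 < eps &
    forall (E : nat -> set (heis R n)) (de : nat -> R),
    (forall i, 0 <= de i <= eps) ->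
    (forall i x y, E i x -> E i y -> koranyi_dist x y <= de i) ->
    (forall N, \sum_(0 <= i < N) de i `^ t <= eps) ->
    ~ vert_projL (val V) @` A `<=` \bigcup_i E i}.
Proof.
move=> /suslin_borel[C sC AC] M1 t0 ts sbe A0.
have s0 : 0 < s by apply: lt_trans ts.
have r01 := ratio01 s0; set lam := ratio s in r01 A0.
set d := (n + n).+1 in A0 *; set code := digits d (box_coord M) in A0.
pose a := net_content code lam (A `&` box M) / 2.
have a0 : 0 < a by rewrite divr_gt0.
have aA : a < net_content code lam (A `&` box M) by rewrite /a; lra.
rewrite AC in aA; have [b bP] := @bounded_slice_net_content R (heis R n) code lam C (box M) a r01 aA.
(* Starting at the root gives the Frostman bound for all cells down to level [d * k], that is, down
   to cubes of side 2^-k in the rescaled coordinates. *)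
have LP0 k : exists L : seq (R * heis R n), [/\ \sum_(p <- L) p.1 = a,
    forall p, p \in L -> [/\ 0 <= p.1, bounded_slice C b k p.2 & box M p.2] &
    forall v, (size v <= d * k)%N -> mass L (cell code v) <= lam ^+ size v].
  have [|L [La LA Lv]] := @frostman_list R (heis R n) code lam r01
    (bounded_slice C b k `&` box M) (d * k)%N [::] a.
    by rewrite (ltW a0) cell_nil setIT ltW.
  by exists L; split => // p /LA[p0 [bp pM] _].
have /boolp.choice[L LP] := LP0.
have [Cc Cc0 CcP] := pr_collision_le hm hmu M1.
pose sig : R := 2^-1 `^ s; pose th : R := 2^-1 ^+ (n + n - m); pose tau : R := 2 `^ t.
have tau0 : 0 < tau by exact: powR_gt0.
have th0 : 0 <= th by rewrite exprn_ge0.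
have th_sig : th < sig by rewrite /th -powR_mulrn//; exact: powR_half_lt.
have ts1 : tau * sig < 1.
  rewrite -[ltRHS](_ : tau * 2^-1 `^ t = 1).
    by rewrite ltr_pM2l//; exact: powR_half_lt.
  by rewrite /tau -powRM// mulfV// powR1.
have K0 : 0 <= (3 ^ d)%:R :> R by [].
pose Bd := a * (Cc * (3 ^ d)%:R * (1 - th / sig)^-1 * (1 - tau * sig)^-1).
have energy k : \sum_(0 <= j < k.+1) tau ^+ j * (\sum_(p <- L k) p.1 *
    \sum_(q <- L k) q.1 * pr mu (collision (hmn := hmn) M j p.2 q.2)) <= Bd.
  have [La LA Lv] := LP k.
  have := @energy_bound R (heis R n) (fun j p q => pr mu (collision (hmn := hmn) M j p q))
    (coord_close d (box_coord M)) (box M) Cc (3 ^ d)%:R sig th tau (ltW Cc0) K0 th0 th_sig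
    (ltW tau0) ts1 CcP (L k) k.
  rewrite La; apply.
    by move=> p /LA[].
  move=> i p ik pL; have [_ _ pM] := LA p pL; rewrite -ratio_exp.
  apply: (ball_mass (B := box M)) => //.
  - by move=> x j xM _; exact: box_coord_bounds.
  - by rewrite exprn_ge0// ltW//; case/andP: r01.
  - by move=> q /LA[].
  by move=> v vi; rewrite -vi; apply: Lv; rewrite vi leq_mul2l ik orbT.
have L0 k p : p \in L k -> 0 <= p.1 by have [_ LA _] := LP k; case/LA.
pose S := energy_set (R := R) (collision (hmn := hmn) M).
have c0 (k : nat) i : 0 <= energy_coef (X := heis R n) tau i.
  by rewrite /energy_coef mulr_ge0// exprn_ge0// ltW.
have mS (k : nat) i : measurable (S i) by exact: measurable_collision.
have SB k : \sum_(i <- energy_index (L k) k) energy_coef tau i * pr mu (S i) <= Bd.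
  rewrite (big_energy_index tau k (fun j p q => pr mu (collision (hmn := hmn) M j p q)))//.
  exact: L0.
have [N [mN N0 NP]] := fatou_simple_sum (l := fun k => energy_index (L k) k)
  (c := fun=> energy_coef tau) (S := fun=> S) c0 mS SB.
exists N; split=> // V /= nV; apply: NP => /= -[B BP]; apply: nV.
have LE k0 : exists2 k, (k0 <= k)%N &
    \sum_(0 <= j < k.+1) (2 `^ t) ^+ j * (\sum_(p <- L k) p.1 *
      \sum_(q <- L k) q.1 * \1_(collision (hmn := hmn) M j p.2 q.2) V) <= B.
  have [k kk kB] := BP k0; exists k => //; move: kB; rewrite /simple_sum.
  by rewrite (big_energy_index tau k (fun j p q => \1_(collision (hmn := hmn) M j p q) V))//; exact: L0.
have La k : \sum_(p <- L k) p.1 = a by have [] := LP k.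
have LA k p : p \in L k -> [/\ 0 <= p.1, bounded_slice C b k p.2 & box M p.2].
  by have [_ LA _] := LP k; exact: LA.
have [eps eps0 epsP] := no_small_cover M1 t0 a0 sC La LA LE.
exists eps => // E de deP Ede deS cov; apply: (epsP E de deP Ede deS).
apply: subset_trans cov; rewrite -AC => _ [p [Ap _] <-].
by exists p.
Qed.

End AlmostEveryPlane.

(** * Hausdorff measures and covers *)

Section NullCovers.
Context {R : realType} {X : Type} (dist : X -> X -> R).
Hypothesis dist_refl : forall x, dist x x = 0.

(** Real bounds [de] on the diameters replace the extended-real gauge, and a single [eps] bounds
    both the diameters and the sum of their powers. *)
Definition small_cover (t eps : R) (A : set X) (E : nat -> set X) (de : nat -> R) :=
  [/\ A `<=` \bigcup_i E i, forall i, 0 <= de i <= eps,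
      forall i x y, E i x -> E i y -> dist x y <= de i &
      forall N, \sum_(0 <= i < N) de i `^ t <= eps].

Definition hnull (t : R) (A : set X) := forall eps, 0 < eps ->
  exists E de, small_cover t eps A E de.

Lemma diam_le (E : set X) (r : R) : (forall x y, E x -> E y -> dist x y <= r) ->
  (diam dist E <= r%:E)%E.
Proof.
by move=> h; apply: ge_ereal_sup => _ [[x y] [Ex Ey] <-]; rewrite lee_fin h.
Qed.

Lemma diam_ge (E : set X) x y : E x -> E y -> ((dist x y)%:E <= diam dist E)%E.
Proof. by move=> Ex Ey; apply: ereal_sup_ubound; exists (x, y). Qed.

Lemma diam_ge0 (E : set X) : E !=set0 -> (0 <= diam dist E)%E.
Proof. by move=> [x Ex]; have := diam_ge Ex Ex; rewrite dist_refl. Qed.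

Lemma gauge_ge0 (t : R) (E : set X) : (0 <= gauge dist t E)%E.
Proof. by rewrite /gauge; case: ifP => // _; exact: poweR_ge0. Qed.

Lemma hausdorff_content_ge0 (t delta : R) (A : set X) :
  (0 <= hausdorff_content dist t delta A)%E.
Proof.
by apply: le_ereal_inf_tmp => _ [E _ <-]; apply: nneseries_ge0 => i _ _; exact: gauge_ge0.
Qed.

Lemma hnull_measure0 (t : R) (A : set X) : 0 < t -> hnull t A ->
  hausdorff_measure dist t A = 0%E.
Proof.
move=> t0 nA; apply/eqP; rewrite eq_le; apply/andP; split; last first.
  apply: (@le_trans _ _ (hausdorff_content dist t 1 A)).
    exact: hausdorff_content_ge0.
  by apply: ereal_sup_ubound; exists 1 => //=.
apply: ge_ereal_sup => _ [delta /= delta0 <-]; apply/lee_addgt0Pr => eps eps0.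
rewrite add0e.
have [|E [de [AE deP Ede deS]]] := nA (Num.min delta eps).
  by rewrite lt_min delta0.
have gE i : (gauge dist t (E i) <= (de i `^ t)%:E)%E.
  have /andP[d0 _] := deP i; rewrite /gauge; case: ifPn => [_|/set0P En].
    by rewrite lee_fin powR_ge0.
  rewrite -poweR_EFin; apply: gt0_ler_poweR => //.
  - exact: ltW.
  - by rewrite in_itv /= leey andbT diam_ge0.
  - by rewrite in_itv /= leey andbT lee_fin.
  exact/diam_le/Ede.
apply: (@le_trans _ _ (\sum_(0 <= i <oo) gauge dist t (E i))%E).
  apply: ereal_inf_lbound; exists E => //; split=> // i.
  apply: le_trans (diam_le (Ede i)) _; rewrite lee_fin.
  by have /andP[_ /le_trans] := deP i; apply; rewrite ge_min lexx.
apply: lime_le; first by apply: is_cvg_nneseries => i _ _; exact: gauge_ge0.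
apply: nearW => N; apply: (@le_trans _ _ (\sum_(0 <= i < N) (de i `^ t)%:E)%E).
  by apply: lee_sum => i _.
by rewrite sumEFin lee_fin; apply: le_trans (deS N) _; rewrite ge_min lexx orbT.
Qed.

Lemma measure0_hnull (t s : R) (A : set X) : 0 < t -> 0 <= s <= t ->
  hausdorff_measure dist s A = 0%E -> hnull t A.
Proof.
(* Diameters at most 1 allow the exponent to grow from [s] to [t]. *)
move=> t0 /andP[s0 st] A0 eps eps0; pose e := Num.min 1 eps.
have e0 : 0 < e by rewrite lt_min ltr01.
have : (hausdorff_content dist s e A < e%:E)%E.
  apply: (@le_lt_trans _ _ 0%E); last by rewrite lte_fin.
  by rewrite -A0; apply: ereal_sup_ubound; exists e.
move=> /ereal_inf_lt[_ [E [AE Ee] <-]] Es.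
(* An empty member has diameter -oo; it gets 0, whose power vanishes because t > 0. *)
pose de i := if E i == set0 then 0 else fine (diam dist (E i)).
have dE i : E i != set0 -> diam dist (E i) = (de i)%:E.
  move=> En; rewrite /de (negbTE En) fineK// ge0_fin_numE.
    by apply: le_lt_trans (Ee i) _; rewrite ltry.
  exact/diam_ge0/set0P.
have de0 i : 0 <= de i.
  rewrite /de; case: ifPn => // En; rewrite fine_ge0//.
  exact/diam_ge0/set0P.
have de1 i : de i <= e.
  have [Ei0|En] := eqVneq (E i) set0; first by rewrite /de Ei0 eqxx ltW.
  by rewrite -lee_fin -dE.
have gE i : ((de i `^ t)%:E <= gauge dist s (E i))%E.
  rewrite /gauge; case: ifPn => [Ei0|En].
    by rewrite /de Ei0 powR0// gt_eqF.
  rewrite dE// poweR_EFin lee_fin.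
  have [->|dn] := eqVneq (de i) 0; first by rewrite powR0 ?gt_eqF// powR_ge0.
  apply: ger_powR => //; rewrite lt_def dn de0/=.
  by apply: le_trans (de1 i) _; rewrite ge_min lexx.
exists E, de; split=> //.
- by move=> i; rewrite de0 /= (le_trans (de1 i))// ge_min lexx orbT.
- move=> i x y Ex Ey; rewrite -lee_fin -dE; first exact: diam_ge.
  by apply/set0P; exists x.
move=> N; rewrite -lee_fin -sumEFin.
apply: (@le_trans _ _ (\sum_(0 <= i < N) gauge dist s (E i))%E).
  by apply: lee_sum => i _.
apply: (@le_trans _ _ (\sum_(0 <= i <oo) gauge dist s (E i))%E).
  by apply: nneseries_lim_ge => i _ _; exact: gauge_ge0.
by apply: le_trans (ltW Es) _; rewrite lee_fin ge_min lexx orbT.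
Qed.

Lemma countable_small_cover {J : countType} (t eps : R) (A : set X)
    (E : J -> set X) (de : J -> R) : 0 < t -> 0 <= eps ->
  A `<=` \bigcup_j E j -> (forall j, 0 <= de j <= eps) ->
  (forall j x y, E j x -> E j y -> dist x y <= de j) ->
  sum_le (fun j => de j `^ t) setT eps ->
  exists E' de', small_cover t eps A E' de'.
Proof.
move=> t0 eps0 AE deP Ede deS.
exists (fun n => if pickle_inv n is Some j then E j else set0),
  (fun n => if pickle_inv n is Some j then de j else 0); split.
- by move=> x /AE[j _ Ejx]; exists (pickle j) => //; rewrite pickleK_inv.
- by move=> n; case: pickle_inv => // ; rewrite lexx.
- by move=> n x y; case: pickle_inv => // j; exact: Ede.
move=> N; pose l := pmap (fun n => pickle_inv n : option J) (index_iota 0 N).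
apply: (@le_trans _ _ (\sum_(j <- l) de j `^ t)); last first.
  apply: deS => //; exact: (pmap_uniq (@pickle_invK J) (iota_uniq _ _)).
rewrite /l; elim: (index_iota 0 N) => [|n r IH]; first by rewrite !big_nil.
rewrite big_cons /=; case: pickle_inv => [j|] /=.
  by rewrite big_cons lerD2l.
by rewrite powR0 ?gt_eqF// add0r.
Qed.

Lemma hnull_bigcup (t : R) (A : nat -> set X) : 0 < t ->
  (forall n, hnull t (A n)) -> hnull t (\bigcup_n A n).
Proof.
move=> t0 nA eps eps0; pose e (n : nat) := eps * 2^-1 ^+ n.+1.
have e0 n : 0 < e n by rewrite mulr_gt0// exprn_gt0.
have /boolp.choice[Ed EP] n : exists Ed : (nat -> set X) * (nat -> R),
    small_cover t (e n) (A n) Ed.1 Ed.2.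
  by have [E [de h]] := nA n (e n) (e0 n); exists (E, de).
have ee n : e n <= eps.
  by rewrite ler_piMr ?(ltW eps0)// exprn_ile1//; lra.
apply: (@countable_small_cover (nat * nat)%type _ _ _
  (fun j => (Ed j.1).1 j.2) (fun j => (Ed j.1).2 j.2)) => //; first exact: ltW.
- move=> x [n _ /= Ax]; have [AE _ _ _] := EP n; have [i _ Ex] := AE x Ax.
  by exists (n, i).
- move=> [n i] /=; have [_ deP _ _] := EP n; have /andP[-> h] := deP i.
  exact: le_trans h (ee n).
- by move=> [n i] x y /=; have [_ _ h _] := EP n; exact: h.
apply: (sum_leW (D := \bigcup_(n in setT) [set (n, i) | i in setT]) (e := eps)) => //.
  by move=> [n i] _; exists n => //; exists i.
apply: (sum_le_bigcup (f := e)); last by apply: sum_half_le; exact: ltW.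
move=> n _ l ul lD; have [_ deP _ deS] := EP n.
have lE : l = [seq (n, i) | i <- map snd l].
  rewrite -map_comp -[LHS]map_id; apply/eq_in_map => p /lD[i _ <-] //.
have ul2 : uniq (map snd l) by move: ul; rewrite {1}lE => /map_uniq.
rewrite lE big_map /=; apply: le_trans (deS (\max_(i <- map snd l) i).+1).
by apply: sum_uniq_le => // i; exact: powR_ge0.
Qed.

End NullCovers.

Section NullContent.
Context {R : realType} {n : nat}.
Variable M : R.
Hypothesis M1 : 1 <= M.

Let d := (n + n).+1.
Let code := digits d (box_coord (n := n) M).

(* The slabs are cut along the tilted height [p.2 - omega p0.1 p.1 / 2], where p0
   is a point of the cell. *)
Lemma cell_slabs : exists2 C : R, 1 <= C & forall u : seq bool,
  let r := 2^-1 ^+ (size u %/ d) in exists slab : heis R n -> nat,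
  (forall p, box M p -> cell code u p -> (slab p)%:R <= C / r) /\
  (forall p q, box M p -> box M q -> cell code u p -> cell code u q ->
    slab p = slab q -> koranyi_dist p q <= C * r).
Proof.
(* Inside one cell, [c1 * r] bounds the horizontal and the vertical differences, [c2 * r] the
   deviation of the tilted height from its value at [p0], and [c3 * r] the size of one slab up to
   the factor 3 of [koranyi_norm_ge]. *)
pose c1 : R := (n + n).+1%:R * (2 * M + 1).
pose N : R := (2 * n)%:R; pose c0 : R := (n + n)%:R * M.
pose c2 : R := c1 + N * (c0 * c1).
pose c3 : R := 1 + N * c1 ^+ 2 + c1.
have M0 : 0 <= M by apply: le_trans M1.
have M21 : 0 <= 2 * M + 1 by rewrite addr_ge0// mulr_ge0.
have c10 : 0 <= c1 by rewrite mulr_ge0.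
have c00 : 0 <= c0 by rewrite mulr_ge0.
have N0 : 0 <= N by [].
have Nc : 0 <= N * c1 ^+ 2 by rewrite mulr_ge0// exprn_ge0.
have Ncc : 0 <= N * (c0 * c1) by rewrite !mulr_ge0.
have c20 : 0 <= c2 by rewrite addr_ge0.
exists (2 * c2 + 3 * c3); first by rewrite /c3; lra.
move=> u r; have r0 : 0 < r by rewrite exprn_gt0.
have near p q : box M p -> box M q -> cell code u p -> cell code u q ->
    enorm (p.1 - q.1) <= c1 * r /\ `|p.2 - q.2| <= c1 * r.
  move=> pM qM; rewrite /cell /= => pu qu.
  have E : mkseq (code p) (d * (size u %/ d)) = mkseq (code q) (d * (size u %/ d)).
    have h : (d * (size u %/ d) <= size u)%N by rewrite mulnC leq_divM.
    have := congr1 (take (d * (size u %/ d))) (etrans pu (esym qu)).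
    by rewrite /mkseq -!map_take !take_iota (minn_idPl h).
  have cc : coord_close d (box_coord M) (size u %/ d) p q.
    apply/forallP => i.
    apply: (same_cell_close (B := box M) _ _ pM qM E) => //.
    by move=> x j xM _; exact: box_coord_bounds.
  have [h1 h2] := coord_closeP M1 cc; rewrite -/r in h1 h2.
  have h3 : 0 <= (2 * M + 1) * r by rewrite mulr_ge0// ltW.
  rewrite /c1 -natr1; split.
    by apply: le_trans h1 _; lra.
  apply: le_trans h2 _; have : 0 <= (n + n)%:R * ((2 * M + 1) * r) by rewrite mulr_ge0.
  lra.
have [[p0 [p0M p0u]]|none] := pselect (exists p0, box M p0 /\ cell code u p0); last first.
  by exists (fun=> 0%N); split=> p; [move=> pM pu|move=> q pM _ pu]; exfalso; apply: none; exists p.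
pose h (p : heis R n) := p.2 - 2^-1 * omega p0.1 p.1.
have hp0 p : box M p -> cell code u p -> `|h p - h p0| <= c2 * r.
  move=> pM pu; have [e1 e2] := near p p0 pM p0M pu p0u.
  have -> : h p - h p0 = (p.2 - p0.2) - 2^-1 * omega p0.1 (p.1 - p0.1).
    by rewrite /h omegaDr omegaNr; ring.
  have e3 := omega_le p0.1 (p.1 - p0.1).
  have e4 : enorm p0.1 * enorm (p.1 - p0.1) <= c0 * (c1 * r).
    by apply: ler_pM; rewrite ?enorm_ge0//; exact: box_enorm.
  have e5 := ler_wpM2l N0 e4; apply: le_trans (ler_normB _ _) _.
  rewrite [X in _ + X]normrM ger0_norm ?invr_ge0//.
  have := normr_ge0 (omega p0.1 (p.1 - p0.1)); rewrite /c2 -/N in e3 *; lra.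
pose y p := (h p - h p0 + c2 * r) / r ^+ 2.
have r2 : 0 < r ^+ 2 by rewrite exprn_gt0.
have y0 p : box M p -> cell code u p -> 0 <= y p.
  move=> pM pu; have := hp0 p pM pu; rewrite ler_norml => /andP[e1 _].
  by rewrite divr_ge0 ?(ltW r2)//; lra.
exists (fun p => Num.truncn (y p)); split=> [p pM pu|p q pM qM pu qu pq].
  have /andP[e1 _] := truncn_itv (y0 p pM pu); apply: le_trans e1 _.
  have := hp0 p pM pu; rewrite ler_norml => /andP[_ e2].
  rewrite /y ler_pdivrMr// expr2 mulrA divfK ?gt_eqF//.
  have : 0 <= 3 * c3 * r by rewrite !mulr_ge0 ?(ltW r0)// /c3; lra.
  lra.
have := truncn_dist (y0 p pM pu) (y0 q qM qu) pq.
have -> : y p - y q = (h p - h q) / r ^+ 2 by rewrite /y; field; rewrite gt_eqF.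
rewrite normrM [X in _ * X]ger0_norm ?invr_ge0 ?(ltW r2)// ler_pdivrMr// mul1r => hpq.
have [e1 _] := near p q pM qM pu qu.
have [e0 _] := near p0 q p0M qM p0u qu.
apply: (@le_trans _ _ (3 * (c3 * r))); last first.
  have : 0 <= c2 * r by rewrite mulr_ge0// ltW.
  lra.
have c30 : 0 <= c3 by rewrite /c3; lra.
apply: koranyi_norm_ge; rewrite ?mulr_ge0 ?(ltW r0)//=.
  rewrite addrC; apply: le_trans e1 _; rewrite ler_pM2r// /c3; lra.
(* The tilt turns the twist into omega of two differences inside the cell, which is of second order
   in [r]; the untilted twist would only be of first order. *)
have -> : - q.2 + p.2 + 2^-1 * omega (- q.1) p.1 =
    (h p - h q) + 2^-1 * omega (p0.1 - q.1) (p.1 - q.1).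
  by rewrite /h omegaDl !omegaDr !omegaNl !omegaNr omegavv; ring.
apply: le_trans (ler_normD _ _) _.
rewrite [X in _ + X]normrM ger0_norm ?invr_ge0//.
have e3 := omega_le (p0.1 - q.1) (p.1 - q.1).
have e4 : enorm (p0.1 - q.1) * enorm (p.1 - q.1) <= (c1 * r) * (c1 * r).
  by apply: ler_pM; rewrite ?enorm_ge0.
have e5 := ler_wpM2l N0 e4; have e6 := normr_ge0 (omega (p0.1 - q.1) (p.1 - q.1)).
have e7 : r ^+ 2 * (1 + N * c1 ^+ 2) <= (c3 * r) ^+ 2.
  rewrite [leRHS]exprMn [leRHS]mulrC; apply: ler_wpM2l; first exact: ltW.
  rewrite /c3; have : 0 <= (N * c1 ^+ 2) ^+ 2 + c1 ^+ 2 + 2 * (N * c1 ^+ 2) * c1 by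
    rewrite !addr_ge0 ?exprn_ge0// !mulr_ge0// exprn_ge0.
  lra.
rewrite -/N in e3; lra.
Qed.

(** A cell of side r yields at most (2C + 1) / r slabs of diameter C r; their powers of exponent s +
    1 sum to a constant times r^s, hence to a constant times the weight of the cell. This is where
    the dimension drops by 1. *)
Lemma hnull_box (s : R) (A : set (heis R n)) : 0 < s ->
  net_content code (ratio (n := n) s) (A `&` box M) <= 0 ->
  hnull koranyi_dist (s + 1) (A `&` box M).
Proof.
move=> s0 A0 eps eps0; have [C C1 CP] := cell_slabs.
pose r (u : seq bool) : R := 2^-1 ^+ (size u %/ d).
have r0 u : 0 < r u by rewrite exprn_gt0.
have /boolp.choice[slab slabP] := CP.
have lam01 := ratio01 (n := n) s0; set lam := ratio s in lam01 A0.
have C0 : 0 < C by lra.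
have s1 : 0 <= s + 1 by lra.
(* The factor 2^s pays for rounding the length of [u] down to a multiple of [d]. *)
have wr u : r u `^ s <= 2 `^ s * weight lam u.
  have -> : r u `^ s = 2 `^ s * (2^-1 `^ s) ^+ (size u %/ d).+1.
    rewrite exprS mulrA -powRM// mulfV// powR1 mul1r.
    by rewrite -powR_mulrn ?powR_ge0// -powRrM mulrC powRrM powR_mulrn.
  rewrite ler_pM2l ?powR_gt0// -(ratio_exp (n := n)) /weight.
  have /andP[l0 l1] := lam01.
  apply: ler_wiXn2l; rewrite ?(ltW l0) ?(ltW l1)//.
  by apply: ltnW; rewrite -/d mulnC -ltn_divLR.
pose K := 2 `^ s * ((2 * C + 1) * C `^ (s + 1)).
have K0 : 0 < K by rewrite !mulr_gt0 ?powR_gt0//; lra.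
pose e := Num.min (eps / K) ((eps / C) `^ s / 2 `^ s).
have e0 : 0 < e by rewrite lt_min !divr_gt0 ?powR_gt0// divr_gt0.
have [D AD De] : covers code lam (A `&` box M) e.
  by apply: (net_content_lt lam01); apply: le_lt_trans A0 e0.
pose E (j : seq bool * nat) := [set p | [/\ D j.1, box M p, cell code j.1 p & slab j.1 p = j.2]].
(* Slabs with index above C / r are empty and get 0, so each cell contributes only finitely many
   nonzero terms. *)
pose de (j : seq bool * nat) : R := if `[< D j.1 /\ j.2%:R <= C / r j.1 >] then C * r j.1 else 0.
have Deps u : D u -> C * r u <= eps.
  move=> Du; rewrite mulrC -ler_pdivlMr//.
  have w1 : weight lam u <= e.
    have := De [:: u] isT; rewrite big_seq1; apply => v.
    by rewrite inE => /eqP ->.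
  have : r u `^ s <= (eps / C) `^ s.
    apply: le_trans (wr u) _; rewrite mulrC -ler_pdivlMr ?powR_gt0//.
    by apply: le_trans w1 _; rewrite ge_min lexx orbT.
  apply: contraTT; rewrite -!ltNge => h.
  by apply: gt0_ltr_powR; rewrite ?nnegrE// ?(ltW (r0 u))// divr_ge0// ltW.
apply: (countable_small_cover (J := (seq bool * nat)%type) (E := E) (de := de)) => //.
- lra.
- exact: ltW.
- move=> p /[dup] /AD[u Du pu] [_ pM]; exists (u, slab u p) => //; split=> //.
- move=> [u i] /=; rewrite /de /=; case: asboolP => [[Du _]|_]; last by rewrite lexx ltW.
  by rewrite mulr_ge0 ?(ltW C0) ?(ltW (r0 u))//= Deps.
- move=> [u i] p q /= [/= Du pM pu pi] [_ qM qu qi].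
  have [h1 h2] := slabP u; rewrite /de /= ifT; first by apply: h2 => //; rewrite pi.
  by apply/asboolP; split=> //; rewrite -pi; exact: h1.
apply: (sum_leW (D := \bigcup_(u in setT) [set (u, i) | i in setT]) (e := eps)) => //.
  by move=> [u i] _; exists u => //; exists i.
apply: (sum_le_bigcup (f := fun u => if `[< D u >] then K * weight lam u else 0)); last first.
  move=> l ul _; rewrite -big_mkcond /= -mulr_sumr -big_filter mulrC -ler_pdivlMr//.
  apply: (@le_trans _ _ e); last by rewrite ge_min lexx.
  apply: De; first exact: filter_uniq.
  by move=> u; rewrite mem_filter => /andP[/asboolP].
move=> u _ l ul lD; case: asboolP => [Du|nD]; last first.
  rewrite big_seq big1// => -[v i] /lD[j _ [<- _]].
  by rewrite /de; case: asboolP => [[]//|_]; rewrite powR0// gt_eqF//; lra.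
pose T := (Num.truncn (C / r u)).+1.
apply: (@le_trans _ _ (T%:R * (C * r u) `^ (s + 1))).
  rewrite (eq_big_seq (fun j : seq bool * nat => if j.2%:R <= C / r u then (C * r u) `^ (s + 1) else 0)).
    rewrite -big_mkcond /= -big_filter big_const_seq count_predT iter_addr_0 -[leLHS]mulr_natl.
    apply: ler_wpM2r; first exact: powR_ge0.
    rewrite ler_nat -(size_map snd) -(size_iota 0 T); apply: uniq_leq_size.
      rewrite map_inj_in_uniq ?filter_uniq// => -[v i] [w j].
      rewrite !mem_filter => /andP[_ /lD[i' _ [<- _]]] /andP[_ /lD[j' _ [<- _]]] /= -> //.
    move=> i /mapP[[v j]]; rewrite mem_filter => /andP[/= jC _] ->.
    rewrite -[_ :: _]/(iota 0 T) mem_iota /= add0n /T ltnS truncn_ge_nat//.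
    by rewrite divr_ge0 ?ltW.
  move=> [v i] /lD[j _ [<- <-]]; rewrite /de /=.
  case: asboolP => [[_ ->]//|h]; case: ifP => [jC|_]; last by rewrite powR0// gt_eqF//; lra.
  by exfalso; apply: h.
have T1 : T%:R <= (2 * C + 1) / r u - 0.
  rewrite subr0 /T -natr1; have /andP[h _] := truncn_itv (divr_ge0 (ltW C0) (ltW (r0 u))).
  have r1 : r u <= 1 by apply: exprn_ile1; lra.
  have i1 : 1 <= (r u)^-1 by rewrite invf_ge1.
  rewrite mulrDl mul1r; nra.
rewrite subr0 in T1.
apply: (@le_trans _ _ ((2 * C + 1) / r u * (C * r u) `^ (s + 1))).
  by apply: ler_wpM2r => //; exact: powR_ge0.
have -> : (2 * C + 1) / r u * (C * r u) `^ (s + 1) = (2 * C + 1) * C `^ (s + 1) * r u `^ s.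
  rewrite powRM ?(ltW C0) ?(ltW (r0 u))// [r u `^ (s + 1)]powRD; last first.
    by apply/implyP => _; rewrite gt_eqF.
  rewrite powRr1 ?(ltW (r0 u))//; field; rewrite gt_eqF//.
have := wr u; rewrite -(@ler_pM2l _ ((2 * C + 1) * C `^ (s + 1))); last first.
  by rewrite mulr_gt0 ?powR_gt0//; lra.
by move=> /le_trans; apply; rewrite /K; lra.
Qed.

End NullContent.

(** * From covers to dimension *)

Section Dimension.
Context {R : realType} {n : nat}.
Implicit Types A : set (heis R n).

Lemma koranyi_dist_refl (p : heis R n) : koranyi_dist p p = 0.
Proof.
have e0 : enorm (0 : 'rV[R]_(n + n)) = 0 by apply/eqP; rewrite enorm_eq0.
rewrite /koranyi_dist /koranyi_norm /heis_mul /heis_inv /= !addNr add0r.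
by rewrite omegaNl omegavv oppr0 mulr0 e0 !expr0n /= mulr0 addr0 powR0// invr_eq0.
Qed.

(** Otherwise the part of [A] in every box would be null for the exponent s + 1, and so would [A], a
    countable union of such parts. *)
Lemma exists_net_content_gt0 A (s : R) : 0 < s -> ((s + 1)%:E < heis_dim A)%E ->
  exists2 M : R, 1 <= M &
    0 < net_content (digits (n + n).+1 (box_coord M)) (ratio (n := n) s) (A `&` box M).
Proof.
move=> s0 sA; apply: contrapT => none.
have null (k : nat) : hnull koranyi_dist (s + 1) (A `&` box k.+1%:R).
  have k1 : 1 <= k.+1%:R :> R by rewrite ler1n.
  apply: (hnull_box k1 s0); rewrite leNgt; apply/negP => h.
  by apply: none; exists k.+1%:R.
have s1 : 0 < s + 1 by lra.
have nA : hnull koranyi_dist (s + 1) A.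
  rewrite (_ : A = \bigcup_k (A `&` box k.+1%:R)); first exact: hnull_bigcup.
  apply/seteqP; split=> [p Ap|p [k _ []]//].
  pose x := enorm p.1 + `|p.2|; have x0 : 0 <= x by rewrite addr_ge0 ?enorm_ge0.
  have /andP[_ h] := truncn_itv x0; have e0 := enorm_ge0 p.1; have p0 := normr_ge0 p.2.
  exists (Num.truncn x) => //; split=> //; split=> [j|].
    apply: le_trans (coord_le_enorm _ _) _; apply: ltW; apply: le_lt_trans h.
    by rewrite lerDl.
  by apply: ltW; apply: le_lt_trans h; rewrite lerDr.
move: sA; rewrite ltNge => /negP; apply; apply: ereal_inf_lbound.
exists (s + 1) => //; split; first exact: ltW.
exact: (hnull_measure0 koranyi_dist_refl).
Qed.

Lemma heis_dim_ge A (T : R) : (forall s, 0 < s < T -> exists2 t, s < t & ~ hnull koranyi_dist t A) ->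
  (T%:E <= heis_dim A)%E.
Proof.
move=> h; apply: le_ereal_inf_tmp => _ [s [s0 sA] <-]; rewrite lee_fin leNgt.
apply/negP => sT; have [|t st nt] := h ((s + T) / 2); first by lra.
apply: nt; apply: (measure0_hnull koranyi_dist_refl _ _ sA); first lra.
by rewrite s0 /=; lra.
Qed.

End Dimension.

Lemma ae_vert_projL_dim {R : realType} {n m : nat} (hm : (1 <= m)%N) (hmn : (m <= n)%N)
    (mu : probability (borelType (isoGrass R hmn)) R) (A : set (heis R n)) (T : R) :
  unitary_invariant mu -> borel A -> 0 < T -> T <= (n + n - m)%:R ->
  ((T + 1)%:E <= heis_dim A)%E ->
  {ae mu, forall V : borelType (isoGrass R hmn),
    (T%:E <= heis_dim (vert_projL (val V) @` A))%E}.
Proof.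
move=> hmu hA T0 Tb TA.
(* Countably many exponents approach [T] from below, so the exceptional sets unite to a null set; k
   + 2 rather than k + 1 keeps every [t k] positive. *)
pose t k : R := T * (1 - k.+2%:R^-1).
have i1 k : 0 < (k.+2%:R : R)^-1 < 1 by rewrite invr_gt0 ltr0n invf_lt1 ?ltr0n// ltr1n.
have t0 k : 0 < t k by have /andP[_ h] := i1 k; rewrite mulr_gt0// subr_gt0.
have tT k : t k < T.
  by have /andP[h _] := i1 k; rewrite /t mulrBr mulr1 gtrBl mulr_gt0.
have ae k : {ae mu, forall V : borelType (isoGrass R hmn),
    ~ hnull koranyi_dist (t k) (vert_projL (val V) @` A)}.
  pose s := (t k + T) / 2.
  have ts : t k < s by rewrite /s; have := tT k; lra.
  have sT : s < T by rewrite /s; have := tT k; lra.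
  have s0 : 0 < s by apply: lt_trans ts.
  have [|M M1 cM] := @exists_net_content_gt0 _ _ A s s0.
    by apply: lt_le_trans TA; rewrite lte_fin ltrD2r.
  have := ae_no_small_cover hm hmu hA M1 (t0 k) ts (lt_le_trans sT Tb) cM.
  apply: filterS => V [eps eps0 h] /(_ eps eps0)[E [de [cov deP Ede deS]]].
  exact: h E de deP Ede deS cov.
have := ae_foralln ae; apply: filterS => V hV.
apply: heis_dim_ge => s /andP[s0 sT].
exists (t (Num.truncn (T / (T - s)))); last exact: hV.
have Ts : 0 < T - s by rewrite subr_gt0.
have x0 : 0 <= T / (T - s) by rewrite divr_ge0// ltW.
have /andP[_ h] := truncn_itv x0; set k := Num.truncn _ in h *.
have {h} : T < k.+2%:R * (T - s).
  rewrite -ltr_pdivrMr//; apply: lt_trans h _; by rewrite ltr_nat.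
rewrite -ltr_pdivrMl ?ltr0n// => h.
by rewrite /t mulrBr mulr1 ltrBrDr [T * _]mulrC addrC -ltrBrDr.
Qed.

Theorem theorem1p3 (R : realType) (n m : nat) (hm : (1 <= m)%N) (hmn : (m <= n)%N)
    (mu : probability (borelType (isoGrass R hmn)) R)
    (hmu : unitary_invariant mu)
    (A : set (heis R n)) (hA : borel A) :
  {ae mu, forall V : borelType (isoGrass R hmn),
    ((2%:E <= heis_dim A <= (2 * n%:R - m%:R + 1)%:E)%E ->
      (heis_dim A - 1%:E <= heis_dim (vert_projL (val V) @` A))%E) /\
    (((2 * n%:R - m%:R + 1)%:E <= heis_dim A <= (2 * n%:R + 1)%:E)%E ->
      ((2 * n%:R - m%:R)%:E <= heis_dim (vert_projL (val V) @` A))%E)}.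
Proof.
have bE : (n + n - m)%:R = 2 * n%:R - m%:R :> R.
  by rewrite natrB ?natrD; [ring|exact: leq_trans hmn (leq_addr _ _)].
have b0 : 1 <= 2 * n%:R - m%:R :> R.
  by rewrite -bE ler1n subn_gt0 (leq_ltn_trans hmn)// -{1}[n]addn0 ltn_add2l (leq_trans hm).
have := fun T => @ae_vert_projL_dim R n m hm hmn mu A T hmu hA.
case: (heis_dim A) => [D| |] dimP.
(* Below 2 both hypotheses fail, since 2n - m >= 1. *)
- have [D2|D2] := ltP D 2.
    apply: aeW => V; split => /andP[]; rewrite !lee_fin => h _; exfalso; lra.
  (* At the common endpoint D = 2n - m + 1 the choice T = D - 1 serves both clauses; above it T = 2n
     - m, the largest exponent allowed. *)
  have [Db|Db] := leP D (2 * n%:R - m%:R + 1).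
    have : {ae mu, forall V : borelType (isoGrass R hmn),
        ((D - 1)%:E <= heis_dim (vert_projL (val V) @` A))%E}.
      by apply: dimP; rewrite ?bE ?lee_fin; lra.
    apply: filterS => V h; split=> [_|/andP[+ _]]; first by rewrite -EFinB.
    by rewrite lee_fin => h'; apply: le_trans h; rewrite lee_fin; lra.
  have : {ae mu, forall V : borelType (isoGrass R hmn),
      ((2 * n%:R - m%:R)%:E <= heis_dim (vert_projL (val V) @` A))%E}.
    by apply: dimP; rewrite ?bE ?lee_fin; lra.
  apply: filterS => V h; split=> // /andP[_]; rewrite lee_fin => h2; exfalso; lra.
- by apply: aeW => V; split=> /andP[_]; rewrite leye_eq.
- by apply: aeW => V; split=> /andP[]; rewrite leeNy_eq.
Qed.
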